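(* Let $\Bbbk$ be an algebraically closed field and $H$ a group. Let $A,B$ be finite dimensional associative unital $\Bbbk$-algebras equipped with $H$-actions $\phi:H\to\mathrm{Aut}(A)$ and $\omega:H\to\mathrm{Aut}(B)$, respectively (group homomorphisms to the groups of $\Bbbk$-algebra automorphisms). Let $$F:\mathcal{D}^b(A)\;\to\;\mathcal{D}^b(B)$$ be an equivalence of triangulated categories such that $F$ intertwines $\Phi$ and $\Omega$, the strict categorical $H$-actions on $\mathcal{D}^b(A)$ and $\mathcal{D}^b(B)$ corresponding to $\phi$ and $\omega$. Then $F$ induces an algebra morphism $$\mathcal{Z}^\phi(A)\;\to\;\mathcal{Z}^\omega(B),$$ which is an isomorphism if $F$ is a strong derived equivalence.
   Context: $\mathcal{D}^b(A)$ is the bounded derived category of the category $A\text{-mod}$ of finite dimensional left $A$-modules. All functors are $\Bbbk$-linear and additive. Extended centre: $\mathcal{Z}^\phi(A)$ is the subalgebra of $A\otimes\Bbbk H$ spanned by all $(a,f):=a\otimes f$, with $a\in A$ and $f\in H$, such that $ab=\phi_f(b)a$ for all $b\in A$. Similarly for $\mathcal{Z}^\omega(B)$. Induced actions: for $\alpha\in\mathrm{Aut}(A)$ and an $A$-module $M$, ${}^\alpha M$ is the $A$-module with the same underlying vector space and with $a\in A$ acting on $v$ by $\alpha(a)v$. Let $\Phi_h$ be the exact functor $M\mapsto{}^{\phi_{h^{-1}}}M$ on $A\text{-mod}$ (identity on underlying linear maps); the induced functors on $\mathcal{D}^b(A)$ are also denoted $\Phi_h$. They satisfy $\Phi_h\circ\Phi_g=\Phi_{hg}$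 and $\Phi_e=\mathrm{Id}$, i.e. they form a strict categorical $H$-action. Similarly $\Omega_h$ is obtained from $\omega$. Intertwining: a functor $K:\mathcal{C}\to\mathcal{D}$ intertwines strict $H$-actions $\Gamma$ on $\mathcal{C}$ and $\Upsilon$ on $\mathcal{D}$ if there are natural transformations $\xi^h:K\circ\Gamma_h\Rightarrow\Upsilon_h\circ K$, for all $h\in H$, with $\xi^e=\mathrm{Id}_K$ and $\Upsilon_k(\xi^h)\circ\xi^k_{\Gamma_h}=\xi^{kh}$ for all $h,k\in H$ (where $\xi^k_{\Gamma_h}$ has components $\xi^k_{\Gamma_hX}$). Strong: a triangulated equivalence $F:\mathcal{D}^b(A)\to\mathcal{D}^b(B)$ is strong if both $F({}_AA)$ and $F^{-1}({}_BB)$ are quasi-isomorphic to complexes contained in one degree. *)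

(* Defs.v *)
From HB Require Import structures.
From mathcomp Require Import all_boot all_order all_algebra falgebra.
From mathcomp Require Import finmap boolp.
From mathcomp.multinomials Require Import monalg.
From mathcomp Require Import zify.

Set Implicit Arguments.
Unset Strict Implicit.
Unset Printing Implicit Defensive.

Import GRing.Theory.
#[local] Obligation Tactic := idtac.
Local Open Scope ring_scope.

(* The morphism spaces of a k-linear category are not packaged as lmodType's: *)
(* the objects of a derived category involve arbitrary vectType's, which      *)
(* makes its morphism types too large for the universe of lmodType.           *)
Section Categories.
Variable k : fieldType.

Record lincat := LinCat {
  ob :> Type;
  hom : ob -> ob -> Type;
  hzero : forall X Y, hom X Y;
  hadd : forall X Y, hom X Y -> hom X Y -> hom X Y;
  hscale : forall X Y, k -> hom X Y -> hom X Y;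
  haddA : forall X Y, associative (@hadd X Y);
  haddC : forall X Y, commutative (@hadd X Y);
  hadd0 : forall X Y, left_id (hzero X Y) (@hadd X Y);
  haddN : forall X Y (f : hom X Y), hadd (hscale (-1) f) f = hzero X Y;
  hscaleA : forall X Y a b (f : hom X Y),
    hscale a (hscale b f) = hscale (a * b) f;
  hscale1 : forall X Y, left_id 1 (@hscale X Y);
  hscaleDr : forall X Y, right_distributive (@hscale X Y) (@hadd X Y);
  hscaleDl : forall X Y a b (f : hom X Y),
    hscale (a + b) f = hadd (hscale a f) (hscale b f);
  idm : forall X, hom X X;
  comp : forall X Y Z, hom Y Z -> hom X Y -> hom X Z;
  comp1m : forall X Y (f : hom X Y), comp (idm Y) f = f;
  compm1 : forall X Y (f : hom X Y), comp f (idm X) = f;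
  compA : forall X Y Z T (f : hom X Y) (g : hom Y Z) (h : hom Z T),
    comp h (comp g f) = comp (comp h g) f;
  compDl : forall X Y Z (g h : hom Y Z) (f : hom X Y),
    comp (hadd g h) f = hadd (comp g f) (comp h f);
  compZl : forall X Y Z a (g : hom Y Z) (f : hom X Y),
    comp (hscale a g) f = hscale a (comp g f);
  compDr : forall X Y Z (g : hom Y Z) (f h : hom X Y),
    comp g (hadd f h) = hadd (comp g f) (comp g h);
  compZr : forall X Y Z a (g : hom Y Z) (f : hom X Y),
    comp g (hscale a f) = hscale a (comp g f) }.

Record functor (C D : lincat) := Functor {
  fob :> C -> D;
  fmor : forall X Y, hom X Y -> hom (fob X) (fob Y);
  fmorD : forall X Y (f g : hom X Y), fmor (hadd f g) = hadd (fmor f) (fmor g);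
  fmorZ : forall X Y a (f : hom X Y), fmor (hscale a f) = hscale a (fmor f);
  fmor1 : forall X, fmor (idm X) = idm (fob X);
  fmorM : forall X Y Z (g : hom Y Z) (f : hom X Y),
    fmor (comp g f) = comp (fmor g) (fmor f) }.

End Categories.

Arguments hzero {k l} X Y.
Arguments idm {k l} X.
Arguments comp {k l X Y Z}.
Arguments fmor {k C D} _ {X Y}.

Notation "g '\com' f" := (comp g f) (at level 40, left associativity).

Section Functors.
Variable k : fieldType.
Implicit Types C D E : lincat k.

Definition isom C (X Y : C) (f : hom X Y) : Prop :=
  exists g : hom Y X, g \com f = idm X /\ f \com g = idm Y.

Definition isomorphic C (X Y : C) : Prop := exists f : hom X Y, isom f.

Definition natural C D (F G : functor C D) (t : forall X, hom (F X) (G X)) :=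
  forall X Y (f : hom X Y), t Y \com fmor F f = fmor G f \com t X.

Lemma fmor0 C D (F : functor C D) X Y : fmor F (hzero X Y) = hzero (F X) (F Y).
Proof.
have e : hadd (fmor F (hzero X Y)) (fmor F (hzero X Y)) = fmor F (hzero X Y).
  by rewrite -fmorD hadd0.
by rewrite -[LHS]hadd0 -(haddN (fmor F (hzero X Y))) -haddA e.
Qed.

Definition fidentity C : functor C C :=
  @Functor _ C C (fun X => X) (fun X Y f => f)
    (fun _ _ _ _ => erefl) (fun _ _ _ _ => erefl)
    (fun=> erefl) (fun _ _ _ _ _ => erefl).

Section Comp.
Variables (C D E : lincat k) (G : functor D E) (F : functor C D).
Fact fcompD X Y (f g : hom X Y) :
  fmor G (fmor F (hadd f g)) = hadd (fmor G (fmor F f)) (fmor G (fmor F g)).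
Proof. by rewrite !fmorD. Qed.
Fact fcompZ X Y a (f : hom X Y) :
  fmor G (fmor F (hscale a f)) = hscale a (fmor G (fmor F f)).
Proof. by rewrite !fmorZ. Qed.
Fact fcomp1 X : fmor G (fmor F (idm X)) = idm _.
Proof. by rewrite !fmor1. Qed.
Fact fcompM X Y Z (g : hom Y Z) (f : hom X Y) :
  fmor G (fmor F (g \com f)) = fmor G (fmor F g) \com fmor G (fmor F f).
Proof. by rewrite !fmorM. Qed.
Definition fcomp : functor C E := Functor fcompD fcompZ fcomp1 fcompM.
End Comp.

Record quasi_inverse C D (F : functor C D) (G : functor D C) : Prop := {
  qinv_unit : exists2 t : forall X : C, hom (fcomp G F X) (fidentity C X),
    natural t & forall X, isom (t X);
  qinv_counit : exists2 t : forall Y : D, hom (fcomp F G Y) (fidentity D Y),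
    natural t & forall Y, isom (t Y) }.

(* The morphism X -> Y that is the identity once X and Y are identified. *)
Definition idto C (X Y : C) (e : X = Y) : hom X Y :=
  match e in _ = Z return hom X Z with erefl => idm X end.

(* Equality of functors is spelled out on objects and, through idto, on       *)
(* morphisms.                                                                 *)
Record strict_action (H : groupType) C := StrictAction {
  sact :> H -> functor C C;
  sact1 : forall X, sact 1%g X = X;
  sactM : forall h g X, sact h (sact g X) = sact (h * g)%g X;
  sact1_mor : forall X Y (f : hom X Y),
    idto (sact1 Y) \com fmor (sact 1%g) f = f \com idto (sact1 X);
  sactM_mor : forall h g X Y (f : hom X Y),
    idto (sactM h g Y) \com fmor (sact h) (fmor (sact g) f) =
    fmor (sact (h * g)%g) f \com idto (sactM h g X) }.

Record intertwiner (H : groupType) C D (K : functor C D)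
    (Gamma : strict_action H C) (Upsilon : strict_action H D) := Intertwiner {
  xi :> forall h X, hom (fcomp K (Gamma h) X) (fcomp (Upsilon h) K X);
  xi_natural : forall h, natural (xi h);
  xi1 : forall X, idto (sact1 Upsilon (K X)) \com xi 1%g X =
    fmor K (idto (sact1 Gamma X));
  xiM : forall h l X,
    idto (sactM Upsilon l h (K X)) \com
      (fmor (Upsilon l) (xi h X) \com xi l (Gamma h X)) =
    xi (l * h)%g X \com fmor K (idto (sactM Gamma l h X)) }.

End Functors.

(* The localization of C at W in the world of k-linear categories: generators *)
(* are the morphisms of C and formal inverses of those in W, relations are    *)
(* the axioms of a k-linear category, k-linearity and functoriality of        *)
(* C -> C[W^-1], and the invertibility of W.                                  *)
Section Localization.
Variables (k : fieldType) (C : lincat k).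
Variable W : forall X Y : C, hom X Y -> Prop.

Inductive word : C -> C -> Type :=
| Wmor X Y (f : hom X Y) : word X Y
| Winv X Y (s : hom X Y) of W s : word Y X
| Wcomp X Y Z of word Y Z & word X Y : word X Z
| Wadd X Y of word X Y & word X Y : word X Y
| Wscale X Y of k & word X Y : word X Y.

Inductive weq : forall X Y, word X Y -> word X Y -> Prop :=
| weq_refl X Y (u : word X Y) : weq u u
| weq_sym X Y (u v : word X Y) : weq u v -> weq v u
| weq_trans X Y (u v w : word X Y) : weq u v -> weq v w -> weq u w
| weq_comp X Y Z (u u' : word Y Z) (v v' : word X Y) :
    weq u u' -> weq v v' -> weq (Wcomp u v) (Wcomp u' v')
| weq_add X Y (u u' v v' : word X Y) :
    weq u u' -> weq v v' -> weq (Wadd u v) (Wadd u' v')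
| weq_scale X Y a (u u' : word X Y) :
    weq u u' -> weq (Wscale a u) (Wscale a u')
| weq_comp1w X Y (u : word X Y) : weq (Wcomp (Wmor (idm Y)) u) u
| weq_compw1 X Y (u : word X Y) : weq (Wcomp u (Wmor (idm X))) u
| weq_compA X Y Z T (u : word X Y) (v : word Y Z) (w : word Z T) :
    weq (Wcomp w (Wcomp v u)) (Wcomp (Wcomp w v) u)
| weq_addA X Y (u v w : word X Y) :
    weq (Wadd u (Wadd v w)) (Wadd (Wadd u v) w)
| weq_addC X Y (u v : word X Y) : weq (Wadd u v) (Wadd v u)
| weq_add0 X Y (u : word X Y) : weq (Wadd (Wmor (hzero X Y)) u) u
| weq_addN X Y (u : word X Y) : weq (Wadd (Wscale (-1) u) u) (Wmor (hzero X Y))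
| weq_scaleA X Y a b (u : word X Y) :
    weq (Wscale a (Wscale b u)) (Wscale (a * b) u)
| weq_scale1 X Y (u : word X Y) : weq (Wscale 1 u) u
| weq_scaleDr X Y a (u v : word X Y) :
    weq (Wscale a (Wadd u v)) (Wadd (Wscale a u) (Wscale a v))
| weq_scaleDl X Y a b (u : word X Y) :
    weq (Wscale (a + b) u) (Wadd (Wscale a u) (Wscale b u))
| weq_compDl X Y Z (u v : word Y Z) (w : word X Y) :
    weq (Wcomp (Wadd u v) w) (Wadd (Wcomp u w) (Wcomp v w))
| weq_compZl X Y Z a (u : word Y Z) (w : word X Y) :
    weq (Wcomp (Wscale a u) w) (Wscale a (Wcomp u w))
| weq_compDr X Y Z (u v : word X Y) (w : word Y Z) :
    weq (Wcomp w (Wadd u v)) (Wadd (Wcomp w u) (Wcomp w v))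
| weq_compZr X Y Z a (u : word X Y) (w : word Y Z) :
    weq (Wcomp w (Wscale a u)) (Wscale a (Wcomp w u))
| weq_mor_comp X Y Z (g : hom Y Z) (f : hom X Y) :
    weq (Wmor (g \com f)) (Wcomp (Wmor g) (Wmor f))
| weq_morD X Y (f g : hom X Y) :
    weq (Wmor (hadd f g)) (Wadd (Wmor f) (Wmor g))
| weq_morZ X Y a (f : hom X Y) :
    weq (Wmor (hscale a f)) (Wscale a (Wmor f))
| weq_invl X Y (s : hom X Y) (Ws : W s) :
    weq (Wcomp (Winv Ws) (Wmor s)) (Wmor (idm X))
| weq_invr X Y (s : hom X Y) (Ws : W s) :
    weq (Wcomp (Wmor s) (Winv Ws)) (Wmor (idm Y)).

(* A morphism of the localization is an equivalence class of words.           *)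
Record lhom X Y := LHom {
  wmem :> word X Y -> Prop;
  wmemP : exists u, wmem = weq u }.

Definition wclass X Y (u : word X Y) : lhom X Y := LHom (ex_intro _ u erefl).
Definition wrepr X Y (f : lhom X Y) : word X Y := projT1 (cid (wmemP f)).

Lemma wreprK X Y (f : lhom X Y) : wclass (wrepr f) = f.
Proof.
rewrite /wrepr; case: cid => u /=; case: f => p pP /= e.
by case: _ / (esym e) in pP *; congr LHom; apply: Prop_irrelevance.
Qed.

Lemma wclass_eq X Y (u v : word X Y) : wclass u = wclass v <-> weq u v.
Proof.
split=> [[e]|uv]; first by rewrite e; apply: weq_refl.
have e : weq u = weq v.
  apply: funext => w; apply: propext; split; apply: weq_trans => //.
  exact: weq_sym.
rewrite /wclass; move: (ex_intro _ u _); rewrite e => p.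
by congr LHom; apply: Prop_irrelevance.
Qed.

Lemma wreprP X Y (u : word X Y) : weq (wrepr (wclass u)) u.
Proof. by apply/wclass_eq; rewrite wreprK. Qed.

Lemma lhom_ind X Y (P : lhom X Y -> Prop) :
  (forall u, P (wclass u)) -> forall f, P f.
Proof. by move=> Pu f; rewrite -(wreprK f). Qed.

Definition ladd X Y (f g : lhom X Y) := wclass (Wadd (wrepr f) (wrepr g)).
Definition lscale X Y (a : k) (f : lhom X Y) := wclass (Wscale a (wrepr f)).
Definition lcomp X Y Z (g : lhom Y Z) (f : lhom X Y) :=
  wclass (Wcomp (wrepr g) (wrepr f)).

Lemma laddE X Y (u v : word X Y) :
  ladd (wclass u) (wclass v) = wclass (Wadd u v).
Proof. by apply/wclass_eq; apply: weq_add; apply: wreprP. Qed.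
Lemma lscaleE X Y a (u : word X Y) : lscale a (wclass u) = wclass (Wscale a u).
Proof. by apply/wclass_eq; apply: weq_scale; apply: wreprP. Qed.
Lemma lcompE X Y Z (u : word Y Z) (v : word X Y) :
  lcomp (wclass u) (wclass v) = wclass (Wcomp u v).
Proof. by apply/wclass_eq; apply: weq_comp; apply: wreprP. Qed.

Let lE := (laddE, lscaleE, lcompE).

Program Definition loc : lincat k :=
  @LinCat k C lhom (fun X Y => wclass (Wmor (hzero X Y))) ladd lscale
    _ _ _ _ _ _ _ _ (fun X => wclass (Wmor (idm X))) lcomp _ _ _ _ _ _ _.
Next Obligation.
move=> X Y; elim/lhom_ind=> u; elim/lhom_ind=> v; elim/lhom_ind=> w.
by rewrite !lE; apply/wclass_eq; apply: weq_addA.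
Qed.
Next Obligation.
move=> X Y; elim/lhom_ind=> u; elim/lhom_ind=> v.
by rewrite !lE; apply/wclass_eq; apply: weq_addC.
Qed.
Next Obligation.
move=> X Y; elim/lhom_ind=> u.
by rewrite !lE; apply/wclass_eq; apply: weq_add0.
Qed.
Next Obligation.
move=> X Y; elim/lhom_ind=> u.
by rewrite !lE; apply/wclass_eq; apply: weq_addN.
Qed.
Next Obligation.
move=> X Y a b; elim/lhom_ind=> u.
by rewrite !lE; apply/wclass_eq; apply: weq_scaleA.
Qed.
Next Obligation.
move=> X Y; elim/lhom_ind=> u.
by rewrite !lE; apply/wclass_eq; apply: weq_scale1.
Qed.
Next Obligation.
move=> X Y a; elim/lhom_ind=> u; elim/lhom_ind=> v.
by rewrite !lE; apply/wclass_eq; apply: weq_scaleDr.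
Qed.
Next Obligation.
move=> X Y a b; elim/lhom_ind=> u.
by rewrite !lE; apply/wclass_eq; apply: weq_scaleDl.
Qed.
Next Obligation.
move=> X Y; elim/lhom_ind=> u.
by rewrite !lE; apply/wclass_eq; apply: weq_comp1w.
Qed.
Next Obligation.
move=> X Y; elim/lhom_ind=> u.
by rewrite !lE; apply/wclass_eq; apply: weq_compw1.
Qed.
Next Obligation.
move=> X Y Z T; elim/lhom_ind=> u; elim/lhom_ind=> v; elim/lhom_ind=> w.
by rewrite !lE; apply/wclass_eq; apply: weq_compA.
Qed.
Next Obligation.
move=> X Y Z; elim/lhom_ind=> u; elim/lhom_ind=> v; elim/lhom_ind=> w.
by rewrite !lE; apply/wclass_eq; apply: weq_compDl.
Qed.
Next Obligation.
move=> X Y Z a; elim/lhom_ind=> u; elim/lhom_ind=> v.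
by rewrite !lE; apply/wclass_eq; apply: weq_compZl.
Qed.
Next Obligation.
move=> X Y Z; elim/lhom_ind=> u; elim/lhom_ind=> v; elim/lhom_ind=> w.
by rewrite !lE; apply/wclass_eq; apply: weq_compDr.
Qed.
Next Obligation.
move=> X Y Z a; elim/lhom_ind=> u; elim/lhom_ind=> v.
by rewrite !lE; apply/wclass_eq; apply: weq_compZr.
Qed.

Program Definition locf : functor C loc :=
  @Functor _ C loc (fun X => X) (fun X Y f => wclass (Wmor f)) _ _ _ _.
Next Obligation. by move=> *; rewrite [RHS]laddE; apply/wclass_eq; apply: weq_morD. Qed.
Next Obligation. by move=> *; rewrite [RHS]lscaleE; apply/wclass_eq; apply: weq_morZ. Qed.
Next Obligation. by []. Qed.
Next Obligation. by move=> *; rewrite [RHS]lcompE; apply/wclass_eq; apply: weq_mor_comp. Qed.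

Lemma idto_loc (X Y : C) (e : X = Y) :
  idto (e : X = Y :> loc) = fmor locf (idto e).
Proof. by case: _ / e. Qed.

End Localization.

Section LocFunctor.
Variables (k : fieldType) (C D : lincat k).
Variables (V : forall X Y : C, hom X Y -> Prop).
Variables (W : forall X Y : D, hom X Y -> Prop).
Variables (F : functor C D) (FW : forall X Y (s : hom X Y), V s -> W (fmor F s)).

Fixpoint word_map X Y (u : word V X Y) : word W (F X) (F Y) :=
  match u with
  | Wmor _ _ f => Wmor W (fmor F f)
  | Winv _ _ s Vs => Winv (FW Vs)
  | Wcomp _ _ _ u v => Wcomp (word_map u) (word_map v)
  | Wadd _ _ u v => Wadd (word_map u) (word_map v)
  | Wscale _ _ a u => Wscale a (word_map u)
  end.

Lemma word_map_eq X Y (u v : word V X Y) :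
  weq u v -> weq (word_map u) (word_map v).
Proof.
elim=> {X Y u v} /=; try by [constructor | econstructor; eassumption].
- by move=> X Y u; rewrite fmor1; constructor.
- by move=> X Y u; rewrite fmor1; constructor.
- by move=> X Y u; rewrite fmor0; constructor.
- by move=> X Y u; rewrite fmor0; constructor.
- by move=> X Y Z g f; rewrite fmorM; constructor.
- by move=> X Y f g; rewrite fmorD; constructor.
- by move=> X Y a f; rewrite fmorZ; constructor.
- by move=> X Y s Vs; rewrite fmor1; constructor.
- by move=> X Y s Vs; rewrite fmor1; constructor.
Qed.

Definition lhom_map X Y (f : lhom V X Y) : lhom W (F X) (F Y) :=
  wclass (word_map (wrepr f)).

Lemma lhom_mapE X Y (u : word V X Y) :
  lhom_map (wclass u) = wclass (word_map u).
Proof. by apply/wclass_eq; apply: word_map_eq; apply: wreprP. Qed.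

Program Definition loc_functor : functor (loc V) (loc W) :=
  @Functor _ (loc V) (loc W) F lhom_map _ _ _ _.
Next Obligation.
by move=> X Y; elim/lhom_ind=> u; elim/lhom_ind=> v; rewrite /= laddE !lhom_mapE laddE.
Qed.
Next Obligation.
by move=> X Y a; elim/lhom_ind=> u; rewrite /= lscaleE !lhom_mapE lscaleE.
Qed.
Next Obligation. by move=> X; rewrite lhom_mapE /= fmor1. Qed.
Next Obligation.
by move=> X Y Z; elim/lhom_ind=> u; elim/lhom_ind=> v; rewrite /= lcompE !lhom_mapE lcompE.
Qed.

End LocFunctor.

Section LocAction.
Variables (k : fieldType) (H : groupType) (C : lincat k).
Variable W : forall X Y : C, hom X Y -> Prop.

Lemma wclass_comp X Y Z (u : word W Y Z) (v : word W X Y) :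
  wclass (Wcomp u v) = (wclass u : @hom _ (loc W) Y Z) \com wclass v.
Proof. by rewrite [RHS]lcompE. Qed.
Lemma wclass_add X Y (u v : word W X Y) :
  wclass (Wadd u v) = hadd (wclass u : @hom _ (loc W) X Y) (wclass v).
Proof. by rewrite [RHS]laddE. Qed.
Lemma wclass_scale X Y a (u : word W X Y) :
  wclass (Wscale a u) = hscale a (wclass u : @hom _ (loc W) X Y).
Proof. by rewrite [RHS]lscaleE. Qed.
Lemma wclass_invl X Y (s : hom X Y) (Ws : W s) :
  @comp _ (loc W) X Y X (wclass (Winv Ws)) (fmor (locf W) s) = @idm _ (loc W) X.
Proof. by rewrite [LHS]lcompE; apply/wclass_eq; apply: weq_invl. Qed.
Lemma wclass_invr X Y (s : hom X Y) (Ws : W s) :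
  @comp _ (loc W) Y X Y (fmor (locf W) s) (wclass (Winv Ws)) = @idm _ (loc W) Y.
Proof. by rewrite [LHS]lcompE; apply/wclass_eq; apply: weq_invr. Qed.

Lemma loc_natural (D : lincat k) (F G : functor (loc W) D)
    (t : forall X, hom (F X) (G X)) :
  (forall X Y (f : @hom _ C X Y),
     t Y \com fmor F (fmor (locf W) f) = fmor G (fmor (locf W) f) \com t X) ->
  natural t.
Proof.
move=> tC X Y; elim/lhom_ind; elim=> {X Y}.
- by move=> X Y f; apply: tC.
- move=> X Y s Ws; set si : @hom _ (loc W) Y X := wclass _.
  set sm := fmor (locf W) s.
  rewrite -[LHS]comp1m -fmor1 -(wclass_invl Ws) fmorM -compA [X in _ \com X]compA.
  by rewrite -tC -compA -fmorM wclass_invr fmor1 compm1.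
- move=> X Y Z u IHu v IHv.
  by rewrite wclass_comp !fmorM compA IHu -compA IHv compA.
- by move=> X Y u IHu v IHv; rewrite wclass_add !fmorD compDl compDr IHu IHv.
- by move=> X Y a u IHu; rewrite wclass_scale !fmorZ compZl compZr IHu.
Qed.

Variables (Gamma : strict_action H C).
Hypothesis WG : forall h (X Y : C) (s : hom X Y), W s -> W (fmor (Gamma h) s).

Let LG h : functor (loc W) (loc W) := loc_functor (WG h).

Fact loc_sact1 (X : loc W) : LG 1%g X = X.
Proof. exact: (sact1 Gamma). Qed.
Fact loc_sactM h g (X : loc W) : LG h (LG g X) = LG (h * g)%g X.
Proof. exact: (sactM Gamma). Qed.
Fact loc_functor_mor h (X Y : C) (f : hom X Y) :
  fmor (LG h) (fmor (locf W) f) = fmor (locf W) (fmor (Gamma h) f).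
Proof. exact: lhom_mapE. Qed.
Fact loc_sact1_mor (X Y : loc W) (f : hom X Y) :
  idto (loc_sact1 Y) \com fmor (LG 1%g) f = f \com idto (loc_sact1 X).
Proof.
move: X Y f; apply: (@loc_natural _ (LG 1%g) (fidentity _)) => X Y f.
have e Z : idto (loc_sact1 Z) = fmor (locf W) (idto (sact1 Gamma Z)).
  by rewrite -idto_loc; congr idto.
rewrite loc_functor_mor !e.
by have := congr1 (fun m => fmor (locf W) m) (sact1_mor Gamma f); rewrite !fmorM.
Qed.
Fact loc_sactM_mor h g (X Y : loc W) (f : hom X Y) :
  idto (loc_sactM h g Y) \com fmor (LG h) (fmor (LG g) f) =
  fmor (LG (h * g)%g) f \com idto (loc_sactM h g X).
Proof.
move: X Y f.
apply: (@loc_natural _ (fcomp (LG h) (LG g)) (LG (h * g)%g)) => X Y f.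
have e Z : idto (loc_sactM h g Z) = fmor (locf W) (idto (sactM Gamma h g Z)).
  by rewrite -idto_loc; congr idto.
have eL : fmor (fcomp (LG h) (LG g)) (fmor (locf W) f) =
    fmor (locf W) (fmor (Gamma h) (fmor (Gamma g) f)).
  exact: etrans (congr1 (fmor (LG h)) (loc_functor_mor g f))
                (loc_functor_mor h _).
rewrite eL loc_functor_mor !e.
by have := congr1 (fun m => fmor (locf W) m) (sactM_mor Gamma h g f); rewrite !fmorM.
Qed.

Definition loc_action : strict_action H (loc W) :=
  StrictAction loc_sact1_mor loc_sactM_mor.

End LocAction.

(* A finite dimensional left A-module is a finite dimensional k-vector space  *)
(* with a bilinear unital associative action of A.                            *)
Section Modules.
Variables (k : fieldType) (A : falgType k).

Definition module_axiom (V : vectType k) (act : A -> V -> V) : Prop :=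
  [/\ forall v, linear (act^~ v),
      forall a, linear (act a),
      forall v, act 1 v = v
    & forall a b v, act (a * b) v = act a (act b v)].

Record fdmod := FdMod {
  fdspace :> vectType k;
  act : A -> fdspace -> fdspace;
  actP : module_axiom act }.

Definition complex_axiom (M : int -> fdmod) (d : forall i, 'Hom(M i, M (i + 1)))
  : Prop :=
  [/\ forall i a (x : M i), d i (act a x) = act a (d i x),
      forall i (x : M i), d (i + 1) (d i x) = 0
    & exists n : nat, forall i, n%:Z < `|i| -> forall x : M i, x = 0].

Record complex := Complex {
  cmod :> int -> fdmod;
  diff : forall i, 'Hom(cmod i, cmod (i + 1));
  complexP : complex_axiom diff }.

Record chmap (X Y : complex) := Chmap {
  chm :> forall i, 'Hom(X i, Y i);
  chm_act : forall i a x, chm i (act a x) = act a (chm i x);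
  chm_diff : forall i x, diff Y i (chm i x) = chm (i + 1) (diff X i x) }.

Lemma chmapP X Y (f g : chmap X Y) : (forall i x, f i x = g i x) -> f = g.
Proof.
case: f g => [f fA fD] [g gA gD] /= fg.
have e : f = g by apply: functional_extensionality_dep => i; apply/lfunP => x; exact: fg.
move: gA gD; rewrite -e => gA gD.
by rewrite (Prop_irrelevance fA gA) (Prop_irrelevance fD gD).
Qed.

Lemma act_linearl (M : fdmod) (x : M) : linear (fun a : A => act a x).
Proof. by case: (actP M) => + _ _ _; apply. Qed.
Lemma act_linear (M : fdmod) a : linear (@act M a).
Proof. by case: (actP M) => _ + _ _; apply. Qed.
HB.instance Definition _ (M : fdmod) a :=
  GRing.isLinear.Build k M M _ (@act M a) (@act_linear M a).

Section ChmapModule.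
Variables X Y : complex.
Implicit Types f g : chmap X Y.

Fact chzero_act i a x :
  (0 : 'Hom(X i, Y i)) (act a x) = act a ((0 : 'Hom(_, _)) x).
Proof. by rewrite !lfunE /= linear0. Qed.
Fact chzero_diff i x :
  diff Y i ((0 : 'Hom(X i, Y i)) x) = (0 : 'Hom(_, _)) (diff X i x).
Proof. by rewrite !lfunE /= linear0. Qed.
Definition chzero : chmap X Y := Chmap chzero_act chzero_diff.

Fact chadd_act f g i a x : (f i + g i) (act a x) = act a ((f i + g i) x).
Proof. by rewrite !lfunE /= !chm_act linearD. Qed.
Fact chadd_diff f g i x :
  diff Y i ((f i + g i) x) = (f (i + 1) + g (i + 1)) (diff X i x).
Proof. by rewrite !lfunE /= linearD /= !chm_diff. Qed.
Definition chadd f g := Chmap (chadd_act f g) (chadd_diff f g).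

Fact chscale_act c f i a x : (c *: f i) (act a x) = act a ((c *: f i) x).
Proof. by rewrite !lfunE /= !chm_act linearZ. Qed.
Fact chscale_diff c f i x :
  diff Y i ((c *: f i) x) = (c *: f (i + 1)) (diff X i x).
Proof. by rewrite !lfunE /= linearZ /= !chm_diff. Qed.
Definition chscale c f := Chmap (chscale_act c f) (chscale_diff c f).

End ChmapModule.

Fact chid_act (X : complex) i a (x : X i) : \1%VF (act a x) = act a (\1%VF x).
Proof. by rewrite !id_lfunE. Qed.
Fact chid_diff (X : complex) i (x : X i) : diff X i (\1%VF x) = \1%VF (diff X i x).
Proof. by rewrite !id_lfunE. Qed.
Definition chid X : chmap X X := Chmap (@chid_act X) (@chid_diff X).

Section Comp.
Variables (X Y Z : complex) (g : chmap Y Z) (f : chmap X Y).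
Fact chcomp_act i a x : (g i \o f i)%VF (act a x) = act a ((g i \o f i)%VF x).
Proof. by rewrite !comp_lfunE !chm_act. Qed.
Fact chcomp_diff i x :
  diff Z i ((g i \o f i)%VF x) = (g (i + 1) \o f (i + 1))%VF (diff X i x).
Proof. by rewrite !comp_lfunE !chm_diff. Qed.
Definition chcomp := Chmap chcomp_act chcomp_diff.
End Comp.

Program Definition Cb : lincat k :=
  @LinCat k complex chmap chzero chadd chscale _ _ _ _ _ _ _ _
    chid chcomp _ _ _ _ _ _ _.
Next Obligation.
by do ?move=> ?; apply: chmapP => i x; rewrite !lfunE /= ?lfunE /= ?lfunE /= addrA.
Qed.
Next Obligation.
by do ?move=> ?; apply: chmapP => i x; rewrite !lfunE /= ?lfunE /= ?lfunE /= addrC.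
Qed.
Next Obligation.
by do ?move=> ?; apply: chmapP => i x; rewrite !lfunE /= ?lfunE /= ?lfunE /= add0r.
Qed.
Next Obligation.
by do ?move=> ?; apply: chmapP => i x; rewrite !lfunE /= ?lfunE /= ?lfunE /= scaleN1r addNr.
Qed.
Next Obligation.
by do ?move=> ?; apply: chmapP => i x; rewrite !lfunE /= ?lfunE /= ?lfunE /= scalerA.
Qed.
Next Obligation.
by do ?move=> ?; apply: chmapP => i x; rewrite !lfunE /= ?lfunE /= ?lfunE /= scale1r.
Qed.
Next Obligation.
by do ?move=> ?; apply: chmapP => i x; rewrite !lfunE /= ?lfunE /= ?lfunE /= scalerDr.
Qed.
Next Obligation.
by do ?move=> ?; apply: chmapP => i x; rewrite !lfunE /= ?lfunE /= ?lfunE /= scalerDl.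
Qed.
Next Obligation.
by move=> *; apply: chmapP => i x; rewrite !lfunE /= ?lfunE /= ?lfunE.
Qed.
Next Obligation.
by move=> *; apply: chmapP => i x; rewrite !lfunE /= ?lfunE /= ?lfunE.
Qed.
Next Obligation.
by move=> *; apply: chmapP => i x; rewrite !lfunE /= ?lfunE /= ?lfunE.
Qed.
Next Obligation.
by move=> *; apply: chmapP => i x; rewrite !lfunE /= ?lfunE /= ?lfunE.
Qed.
Next Obligation.
by move=> *; apply: chmapP => i x; rewrite !lfunE /= ?lfunE /= ?lfunE.
Qed.
Next Obligation.
by move=> *; apply: chmapP => i x; rewrite !lfunE /= ?lfunE /= ?lfunE /= linearD.
Qed.
Next Obligation.
by move=> *; apply: chmapP => i x; rewrite !lfunE /= ?lfunE /= ?lfunE /= linearZ.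
Qed.

(* Cohomology is compared in degree i + 1 (every integer is of this form):    *)
(* H(f) is injective and surjective there.                                    *)
Definition qis (X Y : Cb) (f : hom X Y) : Prop := forall i : int,
  (forall x : X (i + 1), diff X (i + 1) x = 0 ->
     (exists y, f (i + 1) x = diff Y i y) -> exists z, x = diff X i z) /\
  (forall y : Y (i + 1), diff Y (i + 1) y = 0 ->
     exists2 x, diff X (i + 1) x = 0 &
       exists z, y - f (i + 1) x = diff Y i z).

Definition Db : lincat k := loc qis.
Definition CbDb : functor Cb Db := locf qis.

Fact zero_module : @module_axiom 'rV[k]_0 (fun _ _ => 0).
Proof.
by split=> [v c a b|a c u v|v|a b v] //; rewrite ?scaler0 ?addr0 // (thinmx0 v).
Qed.
Definition fdmod0 : fdmod := FdMod zero_module.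

Definition stalk_mod (M : fdmod) (i : int) : fdmod := if i == 0 then M else fdmod0.
Fact stalk_complex M :
  complex_axiom (fun i => 0 : 'Hom(stalk_mod M i, stalk_mod M (i + 1))).
Proof.
split=> [i a x|i x|]; rewrite ?lfunE ?linear0 //.
exists 0%N => i; rewrite /stalk_mod; case: (eqVneq i 0) => [->|_ _ x] //.
exact: thinmx0.
Qed.
Definition stalk M : complex := Complex (stalk_complex M).

Fact regular_module : @module_axiom A (fun a x => a * x).
Proof.
split=> [v c a b|a c u v|v|a b v]; rewrite ?mul1r ?mulrA //.
  by rewrite mulrDl scalerAl.
by rewrite mulrDr scalerAr.
Qed.
Definition regular : fdmod := FdMod regular_module.

Definition in_one_degree (X : complex) : Prop :=
  exists n : int, forall i, i != n -> forall x : X i, x = 0.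

End Modules.

Section Triangulated.
Variables (k : fieldType) (A : falgType k).
Implicit Types X Y : complex A.

Fact shift_complex X : complex_axiom (fun i => - diff X (i + 1)).
Proof.
case: (complexP X) => dA dd [n bX]; split=> [i a x|i x|].
- by rewrite !lfunE /= dA linearN.
- by rewrite !opp_lfunE linearN /= dd !oppr0.
- by exists n.+1 => i lti x; apply: bX; move: lti; lia.
Qed.
Definition shift_ob X : complex A := Complex (shift_complex X).

Section ShiftMor.
Variables (X Y : complex A) (f : chmap X Y).
Fact shift_act i a (x : shift_ob X i) : f (i + 1) (act a x) = act a (f (i + 1) x).
Proof. exact: chm_act. Qed.
Fact shift_diff i (x : shift_ob X i) :
  diff (shift_ob Y) i (f (i + 1) x) = f (i + 1 + 1) (diff (shift_ob X) i x).
Proof. by rewrite !lfunE /= chm_diff linearN. Qed.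
Definition shift_mor : hom (shift_ob X : Cb A) (shift_ob Y : Cb A) :=
  @Chmap _ _ (shift_ob X) (shift_ob Y) _ shift_act shift_diff.
End ShiftMor.

Program Definition Cshift : functor (Cb A) (Cb A) :=
  @Functor k (Cb A) (Cb A) shift_ob shift_mor _ _ _ _.
Next Obligation. by move=> *; apply: chmapP. Qed.
Next Obligation. by move=> *; apply: chmapP. Qed.
Next Obligation. by move=> *; apply: chmapP. Qed.
Next Obligation. by move=> *; apply: chmapP. Qed.

Fact shift_qis (X Y : Cb A) (f : hom X Y) : qis f -> qis (fmor Cshift f).
Proof.
move=> qf i; have [fi fs] := qf (i + 1); split.
- move=> x; rewrite lfunE /= => /eqP; rewrite oppr_eq0 => /eqP dx [y].
  rewrite lfunE /= -linearN => fx.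
  have [z ->] := fi x dx (ex_intro _ _ fx).
  by exists (- z); rewrite lfunE /= linearN opprK.
- move=> y; rewrite lfunE /= => /eqP; rewrite oppr_eq0 => /eqP dy.
  have [x dx [z fz]] := fs y dy.
  exists x; first by rewrite lfunE /= dx oppr0.
  by exists (- z); rewrite lfunE /= linearN opprK.
Qed.
Definition shift : functor (Db A) (Db A) := loc_functor shift_qis.

Section Cone.
Variables (X Y : complex A) (f : chmap X Y).

Definition cone_space (i : int) : vectType k := (X (i + 1)%R * Y i)%type.
Definition cone_act i (a : A) (p : cone_space i) : cone_space i := (act a p.1, act a p.2).
Fact cone_module i : module_axiom (@cone_act i).
Proof.
split=> [[u v] c a b|a c [u v] [u' v']|[u v]|a b [u v]]; rewrite /cone_act /=.
- by rewrite !act_linearl.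
- by rewrite !act_linear.
- by case: (actP (X (i + 1))) (actP (Y i)) => _ _ -> _ [_ _ -> _].
- by case: (actP (X (i + 1))) (actP (Y i)) => _ _ _ -> [_ _ _ ->].
Qed.
Definition cone_mod i := FdMod (@cone_module i).

Definition cone_fun i (p : cone_mod i) : cone_mod (i + 1) :=
  (- diff X (i + 1) p.1, f (i + 1) p.1 + diff Y i p.2).
Fact cone_fun_linear i : linear (@cone_fun i).
Proof.
move=> c [u v] [u' v']; congr (_, _); rewrite /= !linearP /= ?opprD ?scalerN //.
by rewrite scalerDr addrACA.
Qed.
HB.instance Definition _ i := GRing.isLinear.Build k (cone_mod i) _ _
  (@cone_fun i) (@cone_fun_linear i).
Definition cone_diff i : 'Hom(cone_mod i, cone_mod (i + 1)) := linfun (@cone_fun i).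

Fact cone_complex : complex_axiom cone_diff.
Proof.
case: (complexP X) (complexP Y) => XA Xd [n Xb] [YA Yd [m Yb]].
split=> [i a [u v]|i [u v]|].
- rewrite !lfunE /= /cone_fun /= /cone_act /= XA YA chm_act.
  by rewrite linearN linearD.
- rewrite !lfunE /= /cone_fun /= linearN /= Xd !oppr0 linearD /= Yd addr0.
  by rewrite chm_diff linearN addNr.
- exists (n + m).+1 => i lti [u v].
  by rewrite (Xb _ _ u) ?(Yb _ _ v) //; lia.
Qed.
Definition cone : complex A := Complex cone_complex.

Definition inc_fun i (y : Y i) : cone i := (0, y).
Fact inc_linear i : linear (@inc_fun i).
Proof. by move=> c u v; congr (_, _); rewrite /= scaler0 addr0. Qed.
HB.instance Definition _ i := GRing.isLinear.Build k (Y i) (cone i) _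
  (@inc_fun i) (@inc_linear i).
Fact inc_act i a (y : Y i) :
  linfun (@inc_fun i) (act a y) = act a (linfun (@inc_fun i) y).
Proof. by rewrite !lfunE /= /inc_fun /= /cone_act /= linear0. Qed.
Fact inc_diff i (y : Y i) :
  diff cone i (linfun (@inc_fun i) y) = linfun (@inc_fun (i + 1)) (diff Y i y).
Proof. by rewrite !lfunE /= /inc_fun /cone_fun /= !linear0 add0r. Qed.
Definition cone_in : hom (Y : Cb A) (cone : Cb A) :=
  @Chmap _ _ Y cone (fun i => linfun (@inc_fun i)) inc_act inc_diff.

Definition out_fun i (p : cone i) : shift_ob X i := p.1.
Fact out_linear i : linear (@out_fun i).
Proof. by []. Qed.
HB.instance Definition _ i := GRing.isLinear.Build k (cone i) _ _
  (@out_fun i) (@out_linear i).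
Fact out_act i a (p : cone i) :
  linfun (@out_fun i) (act a p) = act a (linfun (@out_fun i) p).
Proof. by rewrite !lfunE. Qed.
Fact out_diff i (p : cone i) :
  diff (shift_ob X) i (linfun (@out_fun i) p) =
  linfun (@out_fun (i + 1)) (diff cone i p).
Proof. by rewrite !lfunE. Qed.
Definition cone_out : hom (cone : Cb A) (shift_ob X : Cb A) :=
  @Chmap _ _ cone (shift_ob X) (fun i => linfun (@out_fun i)) out_act out_diff.

End Cone.

(* A triangle is distinguished when it is isomorphic in the derived category  *)
(* to some X -f-> Y -> cone f -> X[1], f a morphism of complexes, with        *)
(* differential (x, y) |-> (- d x, f x + d y) on cone f and - d on X[1].      *)
Definition distinguished (X Y Z : Db A)
    (u : hom X Y) (v : hom Y Z) (w : hom Z (shift X)) : Prop :=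
  exists (X' Y' : Cb A) (f : hom X' Y')
    (a : hom X (CbDb A X')) (b : hom Y (CbDb A Y'))
    (c : hom Z (CbDb A (cone f))),
  [/\ isom a, isom b & isom c] /\
  [/\ b \com u = fmor (CbDb A) f \com a,
      c \com v = fmor (CbDb A) (cone_in f) \com b &
      fmor shift a \com w = fmor (CbDb A) (cone_out f) \com c].

End Triangulated.

Section TriangleFunctor.
Variables (k : fieldType) (A B : falgType k).

Definition triangulated (F : functor (Db A) (Db B)) : Prop :=
  exists2 t : forall X, hom (fcomp F (shift A) X) (fcomp (shift B) F X),
    natural t /\ (forall X, isom (t X)) &
    forall (X Y Z : Db A) (u : hom X Y) (v : hom Y Z) (w : hom Z (shift A X)),
      distinguished u v w ->
      distinguished (fmor F u) (fmor F v) (t X \com fmor F w).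

(* G is a quasi-inverse of F; being quasi-isomorphic means being isomorphic   *)
(* in the derived category.                                                   *)
Definition strong (F : functor (Db A) (Db B)) (G : functor (Db B) (Db A)) :=
  (exists2 Y : Db B, isomorphic (F (stalk (regular A))) Y & in_one_degree Y) /\
  (exists2 X : Db A, isomorphic (G (stalk (regular B))) X & in_one_degree X).

End TriangleFunctor.
(* Every phi_h is an automorphism, with inverse phi_(h^-1).                   *)
Record alg_action (k : fieldType) (H : groupType) (A : falgType k) := AlgAction {
  aact :> H -> {lrmorphism A -> A};
  aact1 : aact 1%g =1 id;
  aactM : forall g h, aact (g * h)%g =1 aact g \o aact h }.

Section Twist.
Variables (k : fieldType) (A : falgType k).

Section TwistBy.
Variable alpha : {lrmorphism A -> A}.

Fact twist_module (M : fdmod A) :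
  module_axiom (fun (a : A) (x : M) => act (alpha a) x).
Proof.
case: (actP M) => Ml Mr M1 MM; split=> [v c a b|a|v|a b v].
- by rewrite linearP Ml.
- exact: Mr.
- by rewrite rmorph1 M1.
- by rewrite rmorphM MM.
Qed.
Definition twist_mod (M : fdmod A) : fdmod A := FdMod (twist_module M).

Fact twist_complexP (X : complex A) :
  @complex_axiom _ _ (fun i => twist_mod (X i)) (diff X).
Proof.
by case: (complexP X) => XA Xd Xb; split=> // i a x; apply: XA.
Qed.
Definition twist_complex (X : complex A) : complex A :=
  Complex (twist_complexP X).

Section TwistMor.
Variables (X Y : complex A) (f : chmap X Y).
Fact twist_act i a (x : twist_complex X i) :
  f i (@act _ _ (twist_mod (X i)) a x) = @act _ _ (twist_mod (Y i)) a (f i x).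
Proof. exact: chm_act. Qed.
Definition twist_mor : chmap (twist_complex X) (twist_complex Y) :=
  @Chmap _ _ (twist_complex X) (twist_complex Y) f twist_act (chm_diff f).
End TwistMor.

Program Definition twist : functor (Cb A) (Cb A) :=
  @Functor k (Cb A) (Cb A) twist_complex twist_mor _ _ _ _.
Next Obligation. by move=> *; apply: chmapP. Qed.
Next Obligation. by move=> *; apply: chmapP. Qed.
Next Obligation. by move=> *; apply: chmapP. Qed.
Next Obligation. by move=> *; apply: chmapP. Qed.

Fact twist_qis (X Y : Cb A) (f : hom X Y) : qis f -> qis (fmor twist f).
Proof. by []. Qed.

End TwistBy.

Section SameSpaces.
Variables (V : int -> vectType k).
Variables (act1 act2 : forall i, A -> V i -> V i).
Hypothesis (act12 : forall i a x, act1 a x = act2 a x :> V i).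
Variables (p1 : forall i, module_axiom (@act1 i)).
Variables (p2 : forall i, module_axiom (@act2 i)).
Variables (d : forall i, 'Hom(V i, V (i + 1))).
Variables (q1 : @complex_axiom k A (fun i => FdMod (p1 i)) d).
Variables (q2 : @complex_axiom k A (fun i => FdMod (p2 i)) d).

Lemma same_spaces : Complex q1 = Complex q2 /\
  (forall e : Complex q1 = Complex q2 :> Cb A, forall i x, idto e i x = x :> V i).
Proof.
have a12 : act1 = act2.
  apply: functional_extensionality_dep => i.
  by apply: funext => a; apply: funext => x; apply: act12.
move: act2 a12 p2 q2 => _ <- p2' q2'.
have p12 : p1 = p2' by apply: Prop_irrelevance.
move: p2' p12 q2' => _ <- q2'.
rewrite (Prop_irrelevance q2' q1); split=> // e i x.
by rewrite (Prop_irrelevance e erefl) /= id_lfunE.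
Qed.
End SameSpaces.

Fact twist_id (alpha : {lrmorphism A -> A}) : alpha =1 id ->
  forall X : Cb A, twist alpha X = X /\
  forall (e : twist alpha X = X) i x, idto e i x = x.
Proof.
move=> alpha1 [M d q] /=.
have [V [a [p eM]]] : exists V a (p : forall i : int, @module_axiom k A (V i) (a i)),
    M = fun i => FdMod (p i).
  exists (fun i => fdspace (M i)), (fun i => @act _ _ (M i)), (fun i => actP (M i)).
  by apply: funext => i; case: (M i).
move: d q; rewrite eM => d q; apply: same_spaces => i b x.
by rewrite alpha1.
Qed.

Fact twist_comp (alpha beta gamma : {lrmorphism A -> A}) :
  beta \o alpha =1 gamma ->
  forall X : Cb A, twist alpha (twist beta X) = twist gamma X /\
  forall (e : twist alpha (twist beta X) = twist gamma X) i x, idto e i x = x.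
Proof.
move=> bag X; apply: (@same_spaces (fun i => X i)) => i a x.
by rewrite /= -bag.
Qed.

End Twist.

Section Action.
Variables (k : fieldType) (H : groupType) (A : falgType k).
Variable phi : alg_action H A.

Let tw (h : H) : functor (Cb A) (Cb A) := twist (phi h^-1%g).

Fact tw1 X : tw 1%g X = X.
Proof.
have p1 : phi 1^-1%g =1 id by rewrite invg1; apply: aact1.
by have [] := twist_id p1 X.
Qed.
Fact tw1E X (e : tw 1%g X = X) i x : idto e i x = x.
Proof.
have p1 : phi 1^-1%g =1 id by rewrite invg1; apply: aact1.
by have [_] := twist_id p1 X; apply.
Qed.
Fact twM h g X : tw h (tw g X) = tw (h * g)%g X.
Proof.
have pM : phi g^-1%g \o phi h^-1%g =1 phi (h * g)^-1%g.
  by move=> a; rewrite invgM aactM.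
by have [] := twist_comp pM X.
Qed.
Fact twME h g X (e : tw h (tw g X) = tw (h * g)%g X) i x : idto e i x = x.
Proof.
have pM : phi g^-1%g \o phi h^-1%g =1 phi (h * g)^-1%g.
  by move=> a; rewrite invgM aactM.
by have [_] := twist_comp pM X; apply.
Qed.

Program Definition complex_action : strict_action H (Cb A) :=
  @StrictAction k H (Cb A) (fun h => twist (phi h^-1%g)) tw1 twM _ _.
Next Obligation.
by move=> X Y f; apply: chmapP => i x; rewrite !comp_lfunE !tw1E.
Qed.
Next Obligation.
by move=> h g X Y f; apply: chmapP => i x; rewrite !comp_lfunE !twME.
Qed.

Definition derived_action : strict_action H (Db A) :=
  @loc_action k H (Cb A) (@qis k A) complex_action
    (fun h => @twist_qis k A (phi h^-1%g)).

End Action.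

Section GroupAlgebra.
Variables (k : fieldType) (A : falgType k) (H : groupType).

(* A (x) kH, as finitely supported functions H -> A; the library's product    *)
(* on {malg A[H]} is restricted to monoids without nontrivial units.          *)
Definition galg : Type := {malg A[H]}.
HB.instance Definition _ := GRing.Zmodule.on galg.

Definition tens (a : A) (f : H) : galg := mkmalgU f a.

Definition galg_scale (c : k) (u : galg) : galg := fgscale (c%:A : A) u.
Definition galg_mul (u v : galg) : galg :=
  \sum_(f <- msupp u) \sum_(g <- msupp v) tens (mcoeff f u * mcoeff g v) (f * g)%g.

Lemma galgP (u v : galg) : (forall f, mcoeff f u = mcoeff f v) -> u = v.
Proof. by move=> e; apply/malgP. Qed.

Fact galg_scaleE c u f : mcoeff f (galg_scale c u) = c *: mcoeff f u.
Proof. by rewrite fgscaleE -scalerAl mul1r. Qed.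
Fact galg_scaleA a b u : galg_scale a (galg_scale b u) = galg_scale (a * b) u.
Proof. by apply: galgP => f; rewrite !galg_scaleE scalerA. Qed.
Fact galg_scale1 : left_id 1 galg_scale.
Proof. by move=> u; apply: galgP => f; rewrite galg_scaleE scale1r. Qed.
Fact galg_scaleDr : right_distributive galg_scale +%R.
Proof.
by move=> c u v; apply: galgP => f; rewrite !(galg_scaleE, mcoeffD) scalerDr.
Qed.
Fact galg_scaleDl u : {morph galg_scale^~ u : a b / a + b}.
Proof.
by move=> a b; apply: galgP => f; rewrite !(galg_scaleE, mcoeffD) scalerDl.
Qed.
HB.instance Definition _ := GRing.Zmodule_isLmodule.Build k galg
  galg_scaleA galg_scale1 galg_scaleDr galg_scaleDl.

Lemma tensD f : {morph tens^~ f : a b / a + b}.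
Proof. exact: monalgUD. Qed.
Lemma tens0 f : tens 0 f = 0.
Proof. exact: monalgU0. Qed.
Lemma tensZ c a f : tens (c *: a) f = c *: tens a f.
Proof.
apply: galgP => g; rewrite galg_scaleE !mcoeffU.
by case: eqP; rewrite ?mulr1n ?mulr0n ?scaler0.
Qed.
Lemma galgE (u : galg) : u = \sum_(f <- msupp u) tens (mcoeff f u) f.
Proof. exact: monalgE. Qed.

Fact galg_mulw (d1 d2 : {fset H}) u v :
  (msupp u `<=` d1)%fset -> (msupp v `<=` d2)%fset ->
  galg_mul u v =
  \sum_(f <- d1) \sum_(g <- d2) tens (mcoeff f u * mcoeff g v) (f * g)%g.
Proof.
move=> le_d1 le_d2; rewrite /galg_mul (big_fset_incl _ le_d1) /=.
  apply/eq_bigr=> f _; apply/big_fset_incl => // g _ /mcoeff_outdom ->.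
  by rewrite mulr0 tens0.
move=> f _ /mcoeff_outdom uf.
by rewrite big1 => // g _; rewrite uf mul0r tens0.
Qed.

Lemma tensM a f b g : galg_mul (tens a f) (tens b g) = tens (a * b) (f * g)%g.
Proof.
by rewrite (galg_mulw msuppU_le msuppU_le) !big_seq_fset1 !mcoeffUU.
Qed.

Fact galg_mulDl : left_distributive galg_mul +%R.
Proof.
move=> u v w.
have sub := fsubset_refl (msupp w).
rewrite (galg_mulw (msuppD_le u v) sub).
rewrite (galg_mulw (fsubsetUl (msupp u) (msupp v)) sub).
rewrite (galg_mulw (fsubsetUr (msupp u) (msupp v)) sub).
rewrite -big_split /=; apply/eq_bigr=> f _.
rewrite -big_split /=; apply/eq_bigr=> g _.
by rewrite mcoeffD mulrDl tensD.
Qed.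
Fact galg_mulDr : right_distributive galg_mul +%R.
Proof.
move=> w u v.
have sub := fsubset_refl (msupp w).
rewrite (galg_mulw sub (msuppD_le u v)).
rewrite (galg_mulw sub (fsubsetUl (msupp u) (msupp v))).
rewrite (galg_mulw sub (fsubsetUr (msupp u) (msupp v))).
rewrite -big_split /=; apply/eq_bigr=> f _.
rewrite -big_split /=; apply/eq_bigr=> g _.
by rewrite mcoeffD mulrDr tensD.
Qed.
Fact galg_mul0 u : galg_mul 0 u = 0.
Proof. by rewrite /galg_mul msupp0 big_seq_fset0. Qed.
Fact galg_mulr0 u : galg_mul u 0 = 0.
Proof.
by rewrite /galg_mul msupp0; apply: big1 => f _; rewrite big_seq_fset0.
Qed.

Fact galg_suml (I : Type) (r : seq I) (F : I -> galg) u :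
  galg_mul (\sum_(i <- r) F i) u = \sum_(i <- r) galg_mul (F i) u.
Proof.
exact: (big_morph (galg_mul^~ u) (fun _ _ => galg_mulDl _ _ _) (galg_mul0 u)).
Qed.
Fact galg_sumr (I : Type) (r : seq I) (F : I -> galg) u :
  galg_mul u (\sum_(i <- r) F i) = \sum_(i <- r) galg_mul u (F i).
Proof.
exact: (big_morph (galg_mul u) (galg_mulDr u) (galg_mulr0 u)).
Qed.

Lemma galg_ind (P : galg -> Prop) :
  P 0 -> (forall u v, P u -> P v -> P (u + v)) -> (forall a f, P (tens a f)) ->
  forall u, P u.
Proof.
move=> P0 PD PU u; rewrite [u]galgE.
by elim/big_ind: _ => // f _; apply: PU.
Qed.

Fact galg_mulA : associative galg_mul.
Proof.
move=> u v w; elim/galg_ind: u => [|u u' IH IH'|a f].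
- by rewrite !galg_mul0.
- by rewrite !galg_mulDl IH IH'.
elim/galg_ind: v => [|v v' IH IH'|b g].
- by rewrite galg_mul0 galg_mulr0 galg_mul0.
- by rewrite galg_mulDl !galg_mulDr IH IH' galg_mulDl.
elim/galg_ind: w => [|w w' IH IH'|c h].
- by rewrite !galg_mulr0.
- by rewrite !galg_mulDr IH IH'.
by rewrite !tensM mulrA mulgA.
Qed.
Fact galg_mul1l : left_id (tens 1 1%g) galg_mul.
Proof.
elim/galg_ind=> [|u v IH IH'|a f].
- exact: galg_mulr0.
- by rewrite galg_mulDr IH IH'.
- by rewrite tensM mul1r mul1g.
Qed.
Fact galg_mul1r : right_id (tens 1 1%g) galg_mul.
Proof.
elim/galg_ind=> [|u v IH IH'|a f].
- exact: galg_mul0.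
- by rewrite galg_mulDl IH IH'.
- by rewrite tensM mulr1 mulg1.
Qed.
Fact galg_1neq0 : tens 1 1%g != 0 :> galg.
Proof. by rewrite monalgU_eq0 oner_eq0. Qed.

HB.instance Definition _ := GRing.Zmodule_isNzRing.Build galg
  galg_mulA galg_mul1l galg_mul1r galg_mulDl galg_mulDr galg_1neq0.

Lemma tens_mul a f b g : tens a f * tens b g = tens (a * b) (f * g)%g.
Proof. exact: tensM. Qed.

Fact galg_scaleAl (c : k) (u v : galg) : c *: (u * v) = (c *: u) * v.
Proof.
elim/galg_ind: u => [|u u' IH IH'|a f]; first by rewrite !(mul0r, scaler0).
  by rewrite !(mulrDl, scalerDr) IH IH'.
elim/galg_ind: v => [|v v' IH IH'|b g]; first by rewrite !(mulr0, scaler0).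
  by rewrite !(mulrDr, scalerDr) IH IH'.
by rewrite -tensZ !tens_mul -tensZ scalerAl.
Qed.
HB.instance Definition _ := GRing.Lmodule_isLalgebra.Build k galg galg_scaleAl.

Fact galg_scaleAr (c : k) (u v : galg) : c *: (u * v) = u * (c *: v).
Proof.
elim/galg_ind: u => [|u u' IH IH'|a f]; first by rewrite !(mul0r, scaler0).
  by rewrite !(mulrDl, scalerDr) IH IH'.
elim/galg_ind: v => [|v v' IH IH'|b g]; first by rewrite !(mulr0, scaler0).
  by rewrite !(mulrDr, scalerDr) IH IH'.
by rewrite -tensZ !tens_mul -tensZ scalerAr.
Qed.
HB.instance Definition _ := GRing.Lalgebra_isAlgebra.Build k galg galg_scaleAr.

End GroupAlgebra.

Section ExtendedCentre.
Variables (k : fieldType) (H : groupType) (A : falgType k).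
Variable phi : alg_action H A.

Definition ext_central (a : A) (f : H) : Prop :=
  forall b, a * b = phi f b * a.

Definition in_ext_centre (u : galg A H) : Prop :=
  exists2 s : seq (k * (A * H)),
    forall p, p \in s -> ext_central p.2.1 p.2.2 &
    u = \sum_(p <- s) p.1 *: tens p.2.1 p.2.2.

Definition ext_centre_pred : {pred galg A H} := fun u => `[< in_ext_centre u >].

Lemma ext_central1 : ext_central 1 1%g.
Proof. by move=> b; rewrite aact1 mul1r mulr1. Qed.
Lemma ext_centralM a f b g :
  ext_central a f -> ext_central b g -> ext_central (a * b) (f * g)%g.
Proof.
by move=> af bg c; rewrite aactM /= -mulrA bg mulrA af -!mulrA.
Qed.

Lemma in_ext_centre_tens a f : ext_central a f -> in_ext_centre (tens a f).
Proof.
move=> af; exists [:: (1, (a, f))] => [p|]; first by rewrite inE => /eqP->.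
by rewrite big_seq1 scale1r.
Qed.

Fact ext_centre_closed : GRing.subalg_closed ext_centre_pred.
Proof.
split=> [|c u v /asboolP[s sP ->] /asboolP[t tP ->]|
          u v /asboolP[s sP ->] /asboolP[t tP ->]]; apply/asboolP.
- exact: in_ext_centre_tens ext_central1.
- exists ([seq (c * p.1, p.2) | p <- s] ++ t) => [p|].
    by rewrite mem_cat => /orP[/mapP[q /sP qP ->]|/tP].
  rewrite big_cat big_map scaler_sumr; congr (_ + _).
  by apply: eq_bigr => p _; rewrite scalerA.
- exists [seq (p.1 * q.1, (p.2.1 * q.2.1, (p.2.2 * q.2.2)%g)) | p <- s, q <- t].
    move=> r /allpairsP[[p q] [/= /sP pP /tP qP ->]] /=.
    exact: ext_centralM.
  rewrite big_allpairs_dep mulr_suml; apply: eq_bigr => p _.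
  rewrite mulr_sumr; apply: eq_bigr => q _ /=.
  by rewrite -scalerAl -scalerAr scalerA tens_mul.
Qed.
HB.instance Definition _ := GRing.isSubalgClosed.Build k (galg A H)
  ext_centre_pred (GRing.subalg_closed_semi ext_centre_closed).

Record ext_centre := ExtCentre {
  ext_val : galg A H;
  ext_valP : ext_val \in ext_centre_pred }.

HB.instance Definition _ := [isSub for ext_val].
HB.instance Definition _ := [Choice of ext_centre by <:].
HB.instance Definition _ := [SubChoice_isSubAlgebra of ext_centre by <:].

Definition ext_tens a f (af : ext_central a f) : ext_centre :=
  ExtCentre (introT (asboolP _) (in_ext_centre_tens af)).

(* Left multiplication by a is a natural morphism X -> Phi_(f^-1) X, since    *)
(* b in A acts on Phi_(f^-1) X as phi_f(b) does on X.                         *)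
Section LeftMul.
Variables (a : A) (f : H) (af : ext_central a f) (X : complex A).

Fact lmul_act i b (x : X i) :
  linfun (@act _ _ (X i) a) (act b x) =
  @act _ _ (complex_action phi f^-1%g X i) b (linfun (@act _ _ (X i) a) x).
Proof.
rewrite !lfunE /= invgK; case: (actP (X i)) => _ _ _ MM.
by rewrite -!MM af.
Qed.
Fact lmul_diff i (x : X i) :
  diff X i (linfun (@act _ _ (X i) a) x) =
  linfun (@act _ _ (X (i + 1)) a) (diff X i x).
Proof. by rewrite !lfunE /=; case: (complexP X) => XA _ _; apply: XA. Qed.
Definition lmul : @hom _ (Cb A) X (complex_action phi f^-1%g X) :=
  @Chmap _ _ X (complex_action phi f^-1%g X)
    (fun i => linfun (@act _ _ (X i) a)) lmul_act lmul_diff.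
End LeftMul.

Definition derived_lmul a f (af : ext_central a f) (X : Db A) :
  hom X (derived_action phi f^-1%g X) := fmor (CbDb A) (lmul af X).

End ExtendedCentre.

(* The natural transformation Id => Phi_(f^-1) given by (a, f) is transported *)
(* along F and xi to Id => Omega_(f^-1) on D^b(B), and its value at B is left *)
(* multiplication by some b with (b, f) in the extended centre of omega; the  *)
(* induced morphism sends (a, f) to (b, f).                                   *)
Definition induced (k : fieldType) (H : groupType) (A B : falgType k)
    (phi : alg_action H A) (omega : alg_action H B) (F : functor (Db A) (Db B))
    (xi : intertwiner F (derived_action phi) (derived_action omega))
    (theta : ext_centre phi -> ext_centre omega) : Prop :=
  forall a f (af : ext_central phi a f),
  exists b (bf : ext_central omega b f),
    theta (ext_tens af) = ext_tens bf /\
    forall (X : Db A) (s : hom (F X) (stalk (regular B))), isom s ->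
      derived_lmul bf (stalk (regular B)) \com s =
      fmor (derived_action omega f^-1%g) s \com
        (xi f^-1%g X \com fmor F (derived_lmul af X)).

(* Main.v *)
(* A pair (a, f) acts on D^b(A) as a natural transformation Id => Phi_(f^-1), *)
(* which F and xi carry to D^b(B). Its value at B commutes with all           *)
(* endomorphisms of B, i.e. with right multiplications, and since             *)
(* Hom(B, X) = H^0(X) in D^b(B) it is left multiplication by a unique b with  *)
(* (b, f) in the extended centre.                                             *)
(*   If F is strong, G(B) is a module Y in degree n and F(A) a module in      *)
(* degree m.                                                                  *)
(* Surjectivity: the transformation of D^b(A) that corresponds to (b, f) is   *)
(* left multiplication by some a at A[-n], hence also at Y, because A[-n]     *)
(* detects morphisms between modules in degree n.                             *)
(* Injectivity: if (a, f) goes to 0 then a annihilates Y, hence all shifts of *)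
(* G(B); by naturality F(a, f) at F(A) vanishes on every morphism from a      *)
(* shift of B, that is, on cohomology. As F(A) is a module in one degree,     *)
(* this morphism is 0, so (a, f) is 0 at A.                                   *)

From HB Require Import structures.
From mathcomp Require Import all_boot all_order all_algebra falgebra.
From mathcomp Require Import finmap boolp zify.
From mathcomp.multinomials Require Import monalg.
Require Import Defs.

Set Implicit Arguments.
Unset Strict Implicit.
Unset Printing Implicit Defensive.

Import Order.TTheory GRing.Theory Num.Theory.
Local Open Scope ring_scope.

(** * Linear categories and intertwiners *)

(** Left multiplication by [a], for a pair [(a, f)] of the extended centre, is natural from the
    identity to the twist by [f^-1] ([derived_lmul_natural]). [transport] carries it along [F] and
    [xi], and [xi_isom] makes this passage reversible.

    Identifying the result needs some control of the localization, whose morphisms are classes of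
    words. There are three tools: null-homotopic maps vanish ([homotopic0]), every morphism is a
    left fraction ([left_fraction]), and equal morphisms agree on cohomology ([fmor_coh]). They show
    that morphisms from [A] in degree [n] to [X] are classes in the [n]-th cohomology of [X]
    ([regular_full], [regular_homotopic0]), and that this object detects morphisms between complexes
    concentrated in degree [n] ([concentrated_hom0]).

    By [derived_lmul_regular], a morphism from a free module of rank one to its twist that commutes
    with all endomorphisms is left multiplication by an extended-central element. So the relation
    [corresponds] is the graph of a function ([corresponds_ex], [corresponds_uniq]). It is linear
    and multiplicative because [transport] is, and it extends coefficientwise to the extended
    centre, since membership there is coefficientwise ([ext_centreP]). For a strong equivalence,
    [corresponds_surj] and [corresponds_inj] give bijectivity on each coefficient. *)

Section LinearCategories.
Variable k : fieldType.
Implicit Types C D : lincat k.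

Lemma hscale0 C (X Y : C) (f : hom X Y) : hscale 0 f = hzero X Y.
Proof. by rewrite -(haddN f) -[f in hadd _ f]hscale1 -hscaleDl addNr. Qed.

Lemma comp0m C (X Y Z : C) (f : hom X Y) : hzero Y Z \com f = hzero X Z.
Proof. by rewrite -(hscale0 (hzero Y Z)) compZl hscale0. Qed.

Lemma compm0 C (X Y Z : C) (f : hom Y Z) : f \com hzero X Y = hzero X Z.
Proof. by rewrite -(hscale0 (hzero X Y)) compZr hscale0. Qed.

Lemma hadd_eq0 C (X Y : C) (f g : hom X Y) :
  hadd f (hscale (-1) g) = hzero X Y -> f = g.
Proof. by move=> e; rewrite -[g]hadd0 -e -haddA haddN haddC hadd0. Qed.

Lemma isom_id C (X : C) : isom (idm X).
Proof. by exists (idm X); rewrite comp1m. Qed.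

Lemma isom_comp C (X Y Z : C) (g : hom Y Z) (f : hom X Y) :
  isom g -> isom f -> isom (g \com f).
Proof.
move=> [g' [g'g gg']] [f' [f'f ff']]; exists (f' \com g'); split.
  by rewrite -compA [g' \com _]compA g'g comp1m f'f.
by rewrite -compA [f \com _]compA ff' comp1m gg'.
Qed.

Lemma isom_fmor C D (F : functor C D) (X Y : C) (f : hom X Y) :
  isom f -> isom (fmor F f).
Proof.
by move=> [g [gf fg]]; exists (fmor F g); rewrite -!fmorM gf fg !fmor1.
Qed.

Lemma isom_idto C (X Y : C) (e : X = Y) : isom (idto e).
Proof. by case: _ / e; apply: isom_id. Qed.

Lemma isom_monol C (X Y Z : C) (s : hom Y Z) (f g : hom X Y) :
  isom s -> s \com f = s \com g -> f = g.
Proof. by move=> [t [ts _]] e; rewrite -[f]comp1m -ts -compA e compA ts comp1m. Qed.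

Lemma isom_monor C (X Y Z : C) (s : hom X Y) (f g : hom Y Z) :
  isom s -> f \com s = g \com s -> f = g.
Proof. by move=> [t [_ st]] e; rewrite -[f]compm1 -st compA e -compA st compm1. Qed.

Lemma isomorphic_sym C (X Y : C) : isomorphic X Y -> isomorphic Y X.
Proof. by move=> [f [g [gf fg]]]; exists g, f. Qed.

Lemma isomorphic_trans C (X Y Z : C) :
  isomorphic X Y -> isomorphic Y Z -> isomorphic X Z.
Proof. by move=> [f fi] [g gi]; exists (g \com f); apply: isom_comp. Qed.

Lemma isomorphic_fmor C D (F : functor C D) (X Y : C) :
  isomorphic X Y -> isomorphic (F X) (F Y).
Proof. by move=> [f fi]; exists (fmor F f); apply: isom_fmor. Qed.

Section Equivalence.
Variables (C D : lincat k) (F : functor C D) (G : functor D C).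
Hypothesis FG : quasi_inverse F G.

Lemma qinv_faithful (X Y : C) (f g : hom X Y) : fmor F f = fmor F g -> f = g.
Proof.
have [t tn ti] := qinv_unit FG => e.
by apply: (isom_monor (ti X)); rewrite -[LHS](tn _ _ f) -[RHS](tn _ _ g) /= e.
Qed.

Lemma qinv_sym : quasi_inverse G F.
Proof. by case: FG => [[t tn ti] [u un ui]]; split; [exists u|exists t]. Qed.

End Equivalence.

Lemma qinv_full C D (F : functor C D) (G : functor D C) :
  quasi_inverse F G ->
  forall (X Y : C) (g : hom (F X) (F Y)), exists f, fmor F f = g.
Proof.
move=> FG X Y g; have [t tn ti] := qinv_unit FG.
have [t' [t't tt']] := ti X.
exists (t Y \com fmor G g \com t').
apply: (qinv_faithful (qinv_sym FG)).
apply: (isom_monol (ti Y)).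
rewrite [LHS](tn _ _ (t Y \com fmor G g \com t')) /=.
rewrite -!compA t't compm1.
reflexivity.
Qed.

Lemma qinv_isom C D (F : functor C D) (G : functor D C) :
  quasi_inverse F G -> forall Y : D, isomorphic (F (G Y)) Y.
Proof. by move=> FG Y; have [t _ ti] := qinv_counit FG; exists (t Y); apply: (ti Y). Qed.

Section Actions.
Variables (H : groupType) (C : lincat k) (S : strict_action H C).

Lemma sact_unit g : g = 1%g ->
  exists2 t : forall X, hom (S g X) X,
    (forall X Y (f : hom X Y), t Y \com fmor (S g) f = f \com t X) &
    forall X, isom (t X).
Proof.
move=> ->; exists (fun X => idto (sact1 S X)); first exact: sact1_mor.
by move=> X; apply: isom_idto.
Qed.

Lemma sact_counit h l : (h * l = 1)%g ->
  exists2 t : forall X, hom (S h (S l X)) X,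
    (forall X Y (f : hom X Y), t Y \com fmor (S h) (fmor (S l) f) = f \com t X) &
    forall X, isom (t X).
Proof.
move=> /sact_unit[t tn ti]; exists (fun X => t X \com idto (sactM S h l X)).
  by move=> X Y f; rewrite -compA sactM_mor [LHS]compA tn -compA.
by move=> X; apply: isom_comp (ti X) (isom_idto _).
Qed.

Lemma sact_qinv h : quasi_inverse (S h) (S h^-1%g).
Proof.
have [t tn ti] := sact_counit (mulVg h).
have [u un ui] := sact_counit (mulgV h).
by split; [exists t|exists u].
Qed.

Lemma sactVK h X : S h^-1%g (S h X) = X.
Proof. by rewrite sactM mulVg sact1. Qed.

End Actions.

Section Intertwiners.
Variables (H : groupType) (C D : lincat k) (K : functor C D).
Variables (Gamma : strict_action H C) (Upsilon : strict_action H D).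
Variable xi : intertwiner K Gamma Upsilon.

Lemma xi1_isom g X : g = 1%g -> isom (xi g X).
Proof.
move=> ->; have [t [ts st]] := isom_idto (sact1 Upsilon (K X)).
have -> : xi 1%g X = t \com fmor K (idto (sact1 Gamma X)).
  by rewrite -(xi1 xi) compA ts comp1m.
apply: isom_comp; first by exists (idto (sact1 Upsilon (K X))).
exact: (isom_fmor K (isom_idto _)).
Qed.

(** The cocycle condition [xiM] identifies this composite, up to isomorphisms, with [xi] at
    [h^-1 * h = 1]. *)
Lemma xiV_isom h X :
  isom (fmor (Upsilon h^-1%g) (xi h X) \com xi h^-1%g (Gamma h X)).
Proof.
set m := _ \com _.
have := xiM xi h h^-1%g X; rewrite -/m => e.
have : isom (idto (sactM Upsilon h^-1%g h (K X)) \com m).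
  rewrite e; apply: isom_comp; first by apply/xi1_isom/mulVg.
  exact: (isom_fmor K (isom_idto _)).
have [t [ts st]] := isom_idto (sactM Upsilon h^-1%g h (K X)).
move=> im; rewrite -[m]comp1m -ts -compA.
by apply: isom_comp im; exists (idto (sactM Upsilon h^-1%g h (K X))).
Qed.

(** Invertibility of [xi h] comes from [H] being a group. [xiV_isom] at [h^-1] gives a left inverse
    on objects [Gamma h^-1 Y], and every object has this form. *)
Lemma xi_retract h X : exists r, r \com xi h X = idm (K (Gamma h X)).
Proof.
suff /(_ (Gamma h X)) : forall Y,
    exists r, r \com xi h (Gamma h^-1%g Y) = idm (K (Gamma h (Gamma h^-1%g Y))).
  by rewrite sactVK.
move=> Y; have [r [r1 _]] := xiV_isom h^-1%g Y; rewrite invgK in r r1.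
by exists (r \com fmor (Upsilon h) (xi h^-1%g Y)); rewrite -compA.
Qed.

(** By [xiV_isom], [xi h X] also acquires a right inverse after applying [Upsilon h^-1]. There the
    left inverse is thus two-sided, and [Upsilon h^-1] is faithful. *)
Lemma xi_isom h X : isom (xi h X).
Proof.
have [r rxi] := xi_retract h X; exists r; split=> //.
have [u [_ e]] := xiV_isom h X; rewrite -compA in e.
apply: (qinv_faithful (sact_qinv Upsilon h^-1%g)).
rewrite fmorM fmor1.
have -> : fmor (Upsilon h^-1%g) r = xi h^-1%g (Gamma h X) \com u.
  by rewrite -[LHS]compm1 -e compA -fmorM rxi fmor1 comp1m.
exact: e.
Qed.

Definition transport h X (f : hom X (Gamma h X)) : hom (K X) (Upsilon h (K X)) :=
  xi h X \com fmor K f.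

Lemma transport_natural h X Y (f : hom X (Gamma h X)) (g : hom Y (Gamma h Y))
    (u : hom X Y) :
  g \com u = fmor (Gamma h) u \com f ->
  transport g \com fmor K u = fmor (Upsilon h) (fmor K u) \com transport f.
Proof.
move=> e; rewrite /transport -compA -fmorM e fmorM [LHS]compA [RHS]compA.
by congr (_ \com _); apply: (xi_natural xi).
Qed.

Lemma transport_natural_inv L (KL : quasi_inverse K L) h X Y
    (f : hom X (Gamma h X)) (g : hom Y (Gamma h Y)) (u : hom X Y) :
  transport g \com fmor K u = fmor (Upsilon h) (fmor K u) \com transport f ->
  g \com u = fmor (Gamma h) u \com f.
Proof.
move=> e; apply: (qinv_faithful KL); apply: (isom_monol (xi_isom h Y)).
rewrite !fmorM [LHS]compA [LHS]e /transport [LHS]compA [RHS]compA.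
by congr (_ \com _); apply/esym/(xi_natural xi).
Qed.

Lemma transport_lift L (KL : quasi_inverse K L) h X
    (g : hom (K X) (Upsilon h (K X))) : exists f, transport (h := h) f = g.
Proof.
have [r [_ xir]] := xi_isom h X; have [f Kf] := qinv_full KL (r \com g).
by exists f; rewrite /transport Kf compA xir comp1m.
Qed.

Lemma transport_inj L (KL : quasi_inverse K L) h X (f g : hom X (Gamma h X)) :
  transport f = transport g -> f = g.
Proof. by move=> /(isom_monol (xi_isom h X))/(qinv_faithful KL). Qed.

(** The index [m] and the equalities [e], [e'] are arbitrary because the use is at [m = (f * g)^-1],
    which equals [g^-1 * f^-1] only propositionally. *)
Lemma transport_comp l h m X (f : hom X (Gamma h X)) (g : hom X (Gamma l X))
    (e : Gamma l (Gamma h X) = Gamma m X)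
    (e' : Upsilon l (Upsilon h (K X)) = Upsilon m (K X)) : m = (l * h)%g ->
  transport (idto e \com (fmor (Gamma l) f \com g)) =
  idto e' \com (fmor (Upsilon l) (transport f) \com transport g).
Proof.
move=> em; subst m; rewrite /transport !fmorM.
rewrite (Prop_irrelevance e (sactM Gamma l h X)).
rewrite (Prop_irrelevance e' (sactM Upsilon l h (K X))).
rewrite [LHS]compA -(xiM xi h l X) -[LHS]compA; congr (_ \com _).
rewrite -[LHS]compA -[RHS]compA; congr (_ \com _).
rewrite [LHS]compA [RHS]compA; congr (_ \com _).
exact: (xi_natural xi).
Qed.

Lemma transport_unit m X (f : hom X (Gamma m X)) (e : Gamma m X = X)
    (e' : Upsilon m (K X) = K X) : m = 1%g ->
  idto e \com f = idm X -> idto e' \com transport f = idm (K X).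
Proof.
move=> em; subst m => ef; rewrite /transport.
rewrite (Prop_irrelevance e' (sact1 Upsilon (K X))) compA [X in X \com _](xi1 xi).
by rewrite -fmorM (Prop_irrelevance (sact1 Gamma X) e) ef fmor1.
Qed.

End Intertwiners.

Section ActionMorphisms.
Variables (H : groupType) (C : lincat k) (S : strict_action H C).

Lemma sactM_mor_eq l h m X Y (f : hom X Y) (eX : S l (S h X) = S m X)
    (eY : S l (S h Y) = S m Y) : m = (l * h)%g ->
  fmor (S m) f \com idto eX = idto eY \com fmor (S l) (fmor (S h) f).
Proof.
move=> em; subst m; rewrite (Prop_irrelevance eX (sactM S l h X)).
by rewrite (Prop_irrelevance eY (sactM S l h Y)) sactM_mor.
Qed.

Lemma sact1_mor_eq m X Y (f : hom X Y) (eX : S m X = X) (eY : S m Y = Y) :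
  m = 1%g -> idto eY \com fmor (S m) f = f \com idto eX.
Proof.
move=> em; subst m; rewrite (Prop_irrelevance eX (sact1 S X)).
by rewrite (Prop_irrelevance eY (sact1 S Y)) sact1_mor.
Qed.

End ActionMorphisms.

End LinearCategories.

(** * Complexes in the derived category *)

Section Complexes.
Variables (k : fieldType) (A : falgType k).
Implicit Types U V W X Y Z : complex A.

(* Boundaries, as an inductive family because the degree i need not be        *)
(* syntactically of the form j + 1.                                           *)
Inductive bd X : forall i, X i -> Prop := Bd j (z : X j) : bd (diff X j z).

Lemma diff_act X i a (x : X i) : diff X i (act a x) = act a (diff X i x).
Proof. by case: (complexP X) => h _ _; apply: h. Qed.

Lemma diffK X i (x : X i) : diff X (i + 1) (diff X i x) = 0.
Proof. by case: (complexP X) => _ h _; apply: h. Qed.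

Lemma bdP X i (y : X (i + 1)) : bd y <-> exists z, y = diff X i z.
Proof.
split=> [by_|[z ->]]; last exact: Bd.
(* The degree is generalised to [j], with a cast along [e], so that [bd] can be eliminated. *)
suff /(_ _ _ by_ erefl) : forall j (x : X j), bd x -> forall (e : j = i + 1),
  exists z, eq_rect j (fun l : int => X l : Type) x (i + 1) e = diff X i z by [].
move=> {y by_} _ _ [j z] e; have ji : j = i by apply: (addIr 1).
by subst j; exists z; rewrite (Prop_irrelevance e erefl).
Qed.

Lemma int_pred (i : int) : exists j, i = j + 1.
Proof. by exists (i - 1); rewrite subrK. Qed.

Lemma bd_lin X i c (x y : X i) : bd x -> bd y -> bd (c *: x + y).
Proof.
have [j ej] := int_pred i; move: x y; rewrite ej => x y.
by move=> /bdP[z ->] /bdP[t ->]; rewrite -linearP; apply: Bd.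
Qed.
Lemma bd0 X i : bd (0 : X i).
Proof. by have [j ->] := int_pred i; rewrite -(linear0 (diff X j)); apply: Bd. Qed.
Lemma bdD X i (x y : X i) : bd x -> bd y -> bd (x + y).
Proof. by move=> bx; rewrite -[x]scale1r; apply: bd_lin. Qed.
Lemma bdZ X i c (x : X i) : bd x -> bd (c *: x).
Proof. by move=> bx; rewrite -[_ *: _]addr0; apply: bd_lin (bd0 _ _). Qed.
Lemma bdN X i (x : X i) : bd x -> bd (- x).
Proof. by rewrite -scaleN1r; apply: bdZ. Qed.
Lemma bd_act X i a (x : X i) : bd x -> bd (act a x).
Proof. by case=> j z; rewrite -diff_act; apply: Bd. Qed.
Lemma bd_cocycle X i (x : X i) : bd x -> diff X i x = 0.
Proof. by case=> j z; apply: diffK. Qed.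
Lemma bd_chm X Y (f : chmap X Y) i (x : X i) : bd x -> bd (f i x).
Proof. by case=> j z; rewrite -chm_diff; apply: Bd. Qed.
Lemma bd_trivial X i (x : X (i + 1)) :
  (forall z : X i, z = 0) -> bd x -> x = 0.
Proof. by move=> X0 /bdP[z ->]; rewrite [z]X0 linear0. Qed.
Lemma bd_trivial' X i (x : X i) :
  (forall z : X (i - 1), z = 0) -> bd x -> x = 0.
Proof.
move=> X0; have [j ej] := int_pred i; move: x X0; rewrite ej => x.
by rewrite addrK; apply: bd_trivial.
Qed.

Lemma qisP X Y (f : chmap X Y) :
  @qis _ A X Y f <-> forall i,
    (forall x : X i, diff X i x = 0 -> bd (f i x) -> bd x) /\
    (forall y : Y i, diff Y i y = 0 ->
      exists2 x, diff X i x = 0 & bd (y - f i x)).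
Proof.
split=> qf i; last first.
  have [fi fs] := qf (i + 1); split=> [x dx /bdP/(fi _ dx)/bdP //|y /fs].
  by move=> [x dx /bdP]; exists x.
have [j ->] := int_pred i; have [fi fs] := qf j; split=> [x dx /bdP|y /fs].
  by move=> /(fi _ dx) xb; apply/bdP.
by move=> [x dx yx]; exists x => //; apply/bdP.
Qed.

Lemma qis_id X : @qis _ A X X (idm (X : Cb A)).
Proof.
apply/qisP => i; split=> [x _|y dy]; first by rewrite id_lfunE.
by exists y => //; rewrite id_lfunE subrr; apply: bd0.
Qed.

Lemma qis_comp X Y Z (g : chmap Y Z) (f : chmap X Y) :
  @qis _ A _ _ g -> @qis _ A _ _ f -> @qis _ A X Z (chcomp g f).
Proof.
move=> /qisP qg /qisP qf; apply/qisP => i.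
have [gi gs] := qg i; have [fi fs] := qf i; split=> [x dx|z dz] /=.
  rewrite comp_lfunE => /gi bx; apply: fi => //; apply: bx.
  by rewrite chm_diff dx linear0.
have [y dy zy] := gs z dz; have [x dx yx] := fs y dy; exists x => //.
rewrite comp_lfunE -(subrK (g i y) z) -addrA -linearB.
by apply: bdD => //; apply: bd_chm.
Qed.

Lemma CbDb_inj X Y (f g : @hom _ (Cb A) X Y) :
  fmor (CbDb A) (hadd f (hscale (-1) g)) = hzero (X : Db A) Y ->
  fmor (CbDb A) f = fmor (CbDb A) g.
Proof. by rewrite fmorD fmorZ; apply: hadd_eq0. Qed.

Lemma CbDb_eq X Y (f g : @hom _ (Cb A) X Y) : (forall i x, f i x = g i x) ->
  fmor (CbDb A) f = fmor (CbDb A) g.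
Proof. by move=> fg; congr fmor; apply: chmapP. Qed.

Lemma CbDbM X Y Z (g : @hom _ (Cb A) Y Z) (f : @hom _ (Cb A) X Y) :
  fmor (CbDb A) (g \com f) =
  (fmor (CbDb A) g : @hom _ (Db A) Y Z) \com (fmor (CbDb A) f : @hom _ (Db A) X Y).
Proof. exact: fmorM. Qed.

Lemma qis_isom X Y (f : chmap X Y) :
  @qis _ A X Y f -> isom (fmor (CbDb A) (f : @hom _ (Cb A) X Y)).
Proof.
by move=> qf; exists (wclass (Winv qf)); rewrite wclass_invl wclass_invr.
Qed.

Definition acyclic U := forall i (x : U i), diff U i x = 0 -> bd x.

(** The zero endomorphism of an acyclic complex is a quasi-isomorphism, so 0 is invertible in the
    derived category. *)
Lemma acyclic_id0 U : acyclic U -> idm (U : Db A) = hzero (U : Db A) U.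
Proof.
move=> aU; have [|t [_ ]] := @qis_isom U U (chzero U U).
  apply/qisP => i; split=> [x dx _|y dy]; first exact: aU.
  by exists 0; rewrite linear0 // subr0; apply: aU.
move=> <-; exact: comp0m.
Qed.

Lemma acyclic_factor U X Y (g : chmap U Y) (f : chmap X U) :
  acyclic U -> fmor (CbDb A) (chcomp g f : @hom _ (Cb A) X Y) = hzero (X : Db A) Y.
Proof.
move=> /acyclic_id0 U0.
rewrite -[chcomp g f]/((g : @hom _ (Cb A) U Y) \com (f : @hom _ (Cb A) X U)).
rewrite fmorM -[fmor _ (f : @hom _ (Cb A) X U)]comp1m.
rewrite -[idm _]/(idm (U : Db A)) U0.
by rewrite comp0m compm0.
Qed.

Lemma cone_id_acyclic X : acyclic (cone (chid X)).
Proof.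
move=> i; have [j ->] := int_pred i; move=> [x y].
rewrite lfunE /= /cone_fun /= id_lfunE => -[_ /eqP].
rewrite addr_eq0 => /eqP ->.
apply/bdP; exists (y, 0).
by rewrite lfunE /= /cone_fun /= id_lfunE linear0 addr0.
Qed.

Section Homotopy.
Variables (X Y : complex A) (f : chmap X Y).
Variable h : forall i, 'Hom(X (i + 1), Y i).
Hypothesis h_act : forall i a x, h i (act a x) = act a (h i x).
Hypothesis fh : forall i x,
  f (i + 1) x = diff Y i (h i x) + h (i + 1) (diff X (i + 1) x).

(** A null-homotopy of [f] amounts to an extension of [f] from [X] to the cone of its identity. That
    cone is acyclic, whence [homotopic0]. *)
Definition homotopy_fun i (p : cone (chid X) i) : Y i := h i p.1 + f i p.2.
Fact homotopy_linear i : linear (@homotopy_fun i).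
Proof. by move=> c u v; rewrite /homotopy_fun !linearP /= scalerDr addrACA. Qed.
HB.instance Definition _ i := GRing.isLinear.Build k (cone (chid X) i) _ _
  (@homotopy_fun i) (@homotopy_linear i).
Fact homotopy_act i a (p : cone (chid X) i) :
  linfun (@homotopy_fun i) (act a p) = act a (linfun (@homotopy_fun i) p).
Proof. by rewrite !lfunE /= /homotopy_fun /= h_act chm_act linearD. Qed.
Fact homotopy_diff i (p : cone (chid X) i) :
  diff Y i (linfun (@homotopy_fun i) p) =
  linfun (@homotopy_fun (i + 1)) (diff (cone (chid X)) i p).
Proof.
rewrite !lfunE /= /homotopy_fun /= /cone_fun /= id_lfunE linearN !linearD /=.
by rewrite fh chm_diff addrCA addrA addrK addrC.
Qed.
Definition homotopy_map : chmap (cone (chid X)) Y :=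
  @Chmap _ _ (cone (chid X)) Y _ homotopy_act homotopy_diff.

Lemma homotopic0 : fmor (CbDb A) (f : @hom _ (Cb A) X Y) = hzero (X : Db A) Y.
Proof.
rewrite -(acyclic_factor homotopy_map (cone_in (chid X)) (@cone_id_acyclic X)).
congr fmor; apply: chmapP => i x.
by rewrite comp_lfunE !lfunE /= /homotopy_fun /= linear0 add0r.
Qed.
End Homotopy.
End Complexes.

(** * Left fractions *)

Section LeftFractions.
Variables (k : fieldType) (A : falgType k).
Implicit Types U V W X Y Z : complex A.

Section DirectSum.
Variables X Y : complex A.

Definition dsum_space (i : int) : vectType k := (X i * Y i)%type.
Definition dsum_act i (a : A) (p : dsum_space i) : dsum_space i :=
  (act a p.1, act a p.2).
Fact dsum_module i : module_axiom (@dsum_act i).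
Proof.
split=> [[u v] c a b|a c [u v] [u' v']|[u v]|a b [u v]]; rewrite /dsum_act /=.
- by rewrite !act_linearl.
- by rewrite !act_linear.
- by case: (actP (X i)) (actP (Y i)) => _ _ -> _ [_ _ -> _].
- by case: (actP (X i)) (actP (Y i)) => _ _ _ -> [_ _ _ ->].
Qed.
Definition dsum_mod i := FdMod (@dsum_module i).

Definition dsum_fun i (p : dsum_mod i) : dsum_mod (i + 1) :=
  (diff X i p.1, diff Y i p.2).
Fact dsum_fun_linear i : linear (@dsum_fun i).
Proof. by move=> c [u v] [u' v']; congr (_, _); rewrite /= linearP. Qed.
HB.instance Definition _ i := GRing.isLinear.Build k (dsum_mod i) _ _
  (@dsum_fun i) (@dsum_fun_linear i).

Fact dsum_complex : complex_axiom (fun i => linfun (@dsum_fun i)).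
Proof.
case: (complexP X) (complexP Y) => XA Xd [n Xb] [YA Yd [m Yb]].
split=> [i a [u v]|i [u v]|].
- by rewrite !lfunE /= /dsum_fun /= /dsum_act /= XA YA.
- by rewrite !lfunE /= /dsum_fun /= Xd Yd.
- exists (n + m)%N => i lti [u v].
  by rewrite (Xb _ _ u) ?(Yb _ _ v) //; lia.
Qed.
Definition dsum : complex A := Complex dsum_complex.

Definition inl_fun i (x : X i) : dsum i := (x, 0).
Fact inl_linear i : linear (@inl_fun i).
Proof. by move=> c u v; congr (_, _); rewrite /= scaler0 addr0. Qed.
HB.instance Definition _ i := GRing.isLinear.Build k (X i) (dsum i) _
  (@inl_fun i) (@inl_linear i).
Fact inl_act i a (x : X i) :
  linfun (@inl_fun i) (act a x) = act a (linfun (@inl_fun i) x).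
Proof. by rewrite !lfunE /= /inl_fun /= /dsum_act /= linear0. Qed.
Fact inl_diff i (x : X i) :
  diff dsum i (linfun (@inl_fun i) x) = linfun (@inl_fun (i + 1)) (diff X i x).
Proof. by rewrite !lfunE /= /inl_fun /dsum_fun /= linear0. Qed.
Definition dsum_inl : chmap X dsum :=
  @Chmap _ _ X dsum (fun i => linfun (@inl_fun i)) inl_act inl_diff.

Definition inr_fun i (y : Y i) : dsum i := (0, y).
Fact inr_linear i : linear (@inr_fun i).
Proof. by move=> c u v; congr (_, _); rewrite /= scaler0 addr0. Qed.
HB.instance Definition _ i := GRing.isLinear.Build k (Y i) (dsum i) _
  (@inr_fun i) (@inr_linear i).
Fact inr_act i a (y : Y i) :
  linfun (@inr_fun i) (act a y) = act a (linfun (@inr_fun i) y).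
Proof. by rewrite !lfunE /= /inr_fun /= /dsum_act /= linear0. Qed.
Fact inr_diff i (y : Y i) :
  diff dsum i (linfun (@inr_fun i) y) = linfun (@inr_fun (i + 1)) (diff Y i y).
Proof. by rewrite !lfunE /= /inr_fun /dsum_fun /= linear0. Qed.
Definition dsum_inr : chmap Y dsum :=
  @Chmap _ _ Y dsum (fun i => linfun (@inr_fun i)) inr_act inr_diff.

End DirectSum.

Section ConeNull.
Variables (X Y : complex A) (f : chmap X Y).

Definition cone_fst_fun i (x : X (i + 1)) : cone f i := (x, 0).
Fact cone_fst_linear i : linear (@cone_fst_fun i).
Proof. by move=> c u v; congr (_, _); rewrite /= scaler0 addr0. Qed.
HB.instance Definition _ i := GRing.isLinear.Build k (X (i + 1)) (cone f i) _
  (@cone_fst_fun i) (@cone_fst_linear i).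

Lemma cone_in_comp0 :
  fmor (CbDb A) ((cone_in f : @hom _ (Cb A) _ _) \com (f : @hom _ (Cb A) _ _)) =
  hzero (X : Db A) (cone f).
Proof.
apply: (homotopic0 (h := fun i => linfun (@cone_fst_fun i))) => [i a x|i x].
  by rewrite !lfunE /= /cone_fst_fun /= /cone_act /= linear0.
rewrite !comp_lfunE !lfunE /= /inc_fun /cone_fst_fun /cone_fun /= linear0 addr0.
by congr (_, _); rewrite /= ?addNr ?addr0.
Qed.
End ConeNull.

(* The cone of (t, -f) : Y -> V (+) W is the homotopy pushout of t and f.     *)
Section Ore.
Variables (Y V W : complex A) (t : chmap Y V) (f : chmap Y W).
Hypothesis qt : @qis _ A Y V t.

Let h : @hom _ (Cb A) Y (dsum V W) :=
  hadd ((dsum_inl V W : @hom _ (Cb A) _ _) \com (t : @hom _ (Cb A) _ _))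
       (hscale (-1) ((dsum_inr V W : @hom _ (Cb A) _ _) \com (f : @hom _ (Cb A) _ _))).

Let hE i y : h i y = (t i y, - f i y).
Proof.
rewrite /= !lfunE /= !lfunE /= !comp_lfunE !lfunE /= /inl_fun /inr_fun.
by congr (_, _); rewrite /= ?scaler0 ?addr0 // scaleN1r add0r.
Qed.

Let f' : @hom _ (Cb A) V (cone h) := cone_in h \com dsum_inl V W.
Let t' : @hom _ (Cb A) W (cone h) := cone_in h \com dsum_inr V W.

Let tE i w : t' i w = (0, (0, w)).
Proof. by rewrite comp_lfunE !lfunE. Qed.

Let dE i y v w : diff (cone h) i (y, (v, w)) =
  (- diff Y (i + 1) y, (t (i + 1) y + diff V i v, - f (i + 1) y + diff W i w)).
Proof. by rewrite lfunE /= /cone_fun hE /= lfunE. Qed.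

(** The quotient of the cone by the image of [W] is the cone of [t], which is acyclic as [t] is a
    quasi-isomorphism. The proof spells this out on elements. *)
Let qt' : @qis _ A _ _ t'.
Proof.
apply/qisP => i; have [j ej] := int_pred i; subst i.
have [ti ts] := (qisP t).1 qt (j + 1); split=> [w dw|].
  rewrite tE => /bdP[[y [v w']]]; rewrite dE => -[].
  move=> /esym/eqP; rewrite oppr_eq0 => /eqP dy.
  move=> /esym/eqP; rewrite addr_eq0 => /eqP tv ->.
  have /bdP[z ->] : bd y by apply: ti => //; rewrite tv; apply: bdN; apply: Bd.
  by rewrite -!chm_diff; apply: bdD; [apply: bdN|]; apply: Bd.
move=> [y [v w]]; rewrite dE => -[].
move=> /eqP; rewrite oppr_eq0 => /eqP dy.
move=> /eqP; rewrite [_ + diff _ _ _]addrC addr_eq0 => /eqP dv.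
move=> /eqP; rewrite [_ + diff _ _ _]addrC subr_eq0 => /eqP dw.
have /bdP[z yz] : bd y.
  have [ti' _] := (qisP t).1 qt (j + 1 + 1); apply: ti' => //.
  by rewrite -[t _ _]opprK -dv; apply: bdN; apply: Bd.
have [|y' dy' /bdP[u vu]] := ts (v + t (j + 1) z).
  by rewrite linearD /= chm_diff dv yz addNr.
(* The element [y' - z] has differential [- y], so subtracting the boundary of [(y' - z, (u, 0))]
   clears the components in [Y] and [V]. *)
exists (w + f (j + 1) (y' - z)).
  have dyz : diff Y (j + 1) (y' - z) = - y by rewrite linearB /= dy' sub0r -yz.
  by rewrite linearD /= chm_diff dyz linearN dw subrr.
apply/bdP; exists (y' - z, (u, 0)).
have dyz : diff Y (j + 1) (y' - z) = - y by rewrite linearB /= dy' sub0r -yz.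
rewrite tE [RHS]dE dyz opprK -vu linear0 [t _ (_ - _)]linearB /=.
congr (_, (_, _)); rewrite /= ?subr0 ?addr0 //.
  by rewrite [RHS]addrC addrA subrK addrK.
by rewrite opprD addrA subrr sub0r.
Qed.

Lemma ore : exists P (g : @hom _ (Cb A) V P) (s : @hom _ (Cb A) W P),
  qis s /\ fmor (CbDb A) (g \com t) = fmor (CbDb A) (s \com f).
Proof.
exists (cone h), f', t'; split; first exact: qt'.
apply: hadd_eq0; rewrite -fmorZ -fmorD -(cone_in_comp0 h); congr fmor.
by rewrite compDr compZr !compA.
Qed.
End Ore.

(** Induction on a word: [ore] moves a denominator past a numerator in a composite, and finds a
    common denominator for a sum. *)
Lemma left_fraction X Y (u : @hom _ (Db A) X Y) :
  exists V (s : @hom _ (Cb A) Y V) (f : @hom _ (Cb A) X V),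
    qis s /\ fmor (CbDb A) s \com u = fmor (CbDb A) f.
Proof.
elim/lhom_ind: u; elim=> {X Y}.
- move=> X Y f; exists Y, (idm (Y : Cb A)), f; split; first exact: qis_id.
  by rewrite fmor1 comp1m.
- move=> X Y s qs; exists Y, s, (idm (Y : Cb A)); split=> //.
  by rewrite wclass_invr fmor1.
- move=> X Y Z u [V [s [f [qs su]]]] v [W [t [g [qt tv]]]].
  have [P [f' [t' [qt' e]]]] := ore f qt.
  exists P, (t' \com s), (f' \com g); split; first exact: qis_comp.
  rewrite wclass_comp !fmorM; move: (wclass u) (wclass v) su tv => u' v' su tv.
  rewrite -[LHS]compA [X in _ \com X]compA su.
  rewrite !fmorM in e; rewrite [LHS]compA -[X in X \com _]e.
  by rewrite -[LHS]compA tv.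
- move=> X Y u [V [s [f [qs su]]]] v [W [t [g [qt tv]]]].
  have [P [f' [t' [qt' e]]]] := ore t qs.
  exists P, (t' \com t), (hadd (f' \com f) (t' \com g)); split; first exact: qis_comp.
  rewrite wclass_add; move: (wclass u) (wclass v) su tv => u' v' su tv.
  rewrite compDr fmorD; congr hadd; last by rewrite !fmorM -[LHS]compA tv.
  by rewrite -e !fmorM -[LHS]compA su.
- move=> X Y a u [V [s [f [qs su]]]].
  by exists V, s, (hscale a f); rewrite wclass_scale compZr su fmorZ.
Qed.

End LeftFractions.

(* The functor H^n on the localization, computed on words. It suffices to     *)
(* map cocycles to cocycles, everything being considered up to boundaries.    *)
Section Cohomology.
Variables (k : fieldType) (A : falgType k) (n : int).
Implicit Types P U V W X Y Z : complex A.

Definition cohomologous X (x y : X n) := bd (x - y).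

Lemma coh_refl X (x : X n) : cohomologous x x.
Proof. by rewrite /cohomologous subrr; apply: bd0. Qed.
Lemma coh_sym X (x y : X n) : cohomologous x y -> cohomologous y x.
Proof. by rewrite /cohomologous -opprB => /bdN; rewrite opprK. Qed.
Lemma coh_trans X (x y z : X n) :
  cohomologous x y -> cohomologous y z -> cohomologous x z.
Proof. by move=> xy /(bdD xy); rewrite addrA subrK. Qed.
Lemma cohD X (x y x' y' : X n) :
  cohomologous x x' -> cohomologous y y' -> cohomologous (x + y) (x' + y').
Proof. by move=> xx' /(bdD xx'); rewrite addrACA -opprD. Qed.
Lemma cohZ X c (x y : X n) :
  cohomologous x y -> cohomologous (c *: x) (c *: y).
Proof. by move=> /(bdZ c); rewrite scalerBr. Qed.
Lemma coh_bd X (x y : X n) : cohomologous x y -> bd y -> bd x.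
Proof. by move=> xy /(bdD xy); rewrite subrK. Qed.

Definition cocycle X (x : X n) := diff X n x = 0.

Lemma cocycle_lin X c (x y : X n) : cocycle x -> cocycle y -> cocycle (c *: x + y).
Proof. by rewrite /cocycle linearP /= => -> ->; rewrite scaler0 addr0. Qed.
Lemma cocycleD X (x y : X n) : cocycle x -> cocycle y -> cocycle (x + y).
Proof. by rewrite /cocycle linearD /= => -> ->; rewrite addr0. Qed.
Lemma cocycleZ X c (x : X n) : cocycle x -> cocycle (c *: x).
Proof. by rewrite /cocycle linearZ /= => ->; rewrite scaler0. Qed.
Lemma cocycleB X (x y : X n) : cocycle x -> cocycle y -> cocycle (x - y).
Proof. by rewrite /cocycle linearB /= => -> ->; rewrite subr0. Qed.
Lemma cocycle_chm X Y (f : chmap X Y) (x : X n) : cocycle x -> cocycle (f n x).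
Proof. by rewrite /cocycle chm_diff => ->; rewrite linear0. Qed.
Lemma cocycle0 X : cocycle (0 : X n).
Proof. exact: linear0. Qed.

(* g induces a linear map on cohomology, though it need not itself be linear. *)
Definition coh_linear X Y (g : X n -> Y n) :=
  [/\ forall x, cocycle x -> cocycle (g x),
      forall c x y, cocycle x -> cocycle y ->
        cohomologous (g (c *: x + y)) (c *: g x + g y)
    & forall x, bd x -> bd (g x)].

Lemma coh_linear_coh X Y (g : X n -> Y n) x y : coh_linear g ->
  cocycle x -> cocycle y -> cohomologous x y -> cohomologous (g x) (g y).
Proof.
move=> [gc gl gb] cx cy xy.
have := gl 1 (x - y) y (cocycleB cx cy) cy; rewrite !scale1r subrK.
move=> /coh_trans; apply; rewrite /cohomologous addrK; exact: gb.
Qed.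

Lemma coh_linearD X Y (g : X n -> Y n) x y : coh_linear g ->
  cocycle x -> cocycle y -> cohomologous (g (x + y)) (g x + g y).
Proof. by move=> [_ gl _] cx cy; have := gl 1 x y cx cy; rewrite !scale1r. Qed.

Lemma coh_linearZ X Y (g : X n -> Y n) c x : coh_linear g ->
  cocycle x -> cohomologous (g (c *: x)) (c *: g x).
Proof.
move=> [_ gl gb] cx; have := gl c x 0 cx (cocycle0 X); rewrite addr0.
move=> /coh_trans; apply.
by rewrite /cohomologous [_ + g 0]addrC addrK; apply/gb/bd0.
Qed.

(** The witness precedes the cocycle hypothesis so that choosing it gives a total function, as
    [coh_word] requires. *)
Lemma qis_lift X Y (s : chmap X Y) (y : Y n) : @qis _ A X Y s ->
  exists x, cocycle y -> cocycle x /\ cohomologous y (s n x).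
Proof.
move=> /qisP/(_ n)[_ h]; case: (pselect (cocycle y)) => [cy|ncy]; last first.
  by exists 0 => /ncy.
by have [x cx yx] := h y cy; exists x.
Qed.

Fixpoint coh_word X Y (u : word (@qis k A) X Y) : X n -> Y n :=
  match u with
  | Wmor _ _ f => fun x => f n x
  | Winv _ _ s qs => fun y => projT1 (cid (qis_lift y qs))
  | Wcomp _ _ _ u v => fun x => coh_word u (coh_word v x)
  | Wadd _ _ u v => fun x => coh_word u x + coh_word v x
  | Wscale _ _ a u => fun x => a *: coh_word u x
  end.

Lemma coh_wordV X Y (s : chmap X Y) (qs : @qis _ A X Y s) (y : Y n) :
  cocycle y ->
  cocycle (coh_word (Winv qs) y) /\ cohomologous y (s n (coh_word (Winv qs) y)).
Proof. by move=> cy /=; case: cid => x /= /(_ cy). Qed.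

Lemma qis_coh_inj X Y (s : chmap X Y) (x x' : X n) : @qis _ A X Y s ->
  cocycle x -> cocycle x' -> cohomologous (s n x) (s n x') -> cohomologous x x'.
Proof.
move=> /qisP/(_ n)[h _] cx cx'; rewrite /cohomologous -linearB.
by apply: h; apply: cocycleB.
Qed.

Lemma coh_word_linear X Y (u : word (@qis k A) X Y) : coh_linear (coh_word u).
Proof.
elim: u => {X Y}.
- move=> X Y f; split=> [x|c x y _ _|x] /=; first exact: cocycle_chm.
    by rewrite linearP; apply: coh_refl.
  exact: bd_chm.
- move=> X Y s qs; set g := coh_word _.
  have gP y : cocycle y -> cocycle (g y) /\ cohomologous y (s n (g y)).
    exact: coh_wordV.
  split=> [y /gP[]//|c x y cx cy|y yb].
    have [cgx xgx] := gP _ cx; have [cgy ygy] := gP _ cy.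
    have [cg eg] := gP _ (cocycle_lin c cx cy).
    apply: (qis_coh_inj qs) => //; first exact: cocycle_lin.
    apply: coh_trans (coh_sym eg) _; rewrite linearP /=.
    by apply: cohD => //; apply: cohZ.
  have [cgy ygy] := gP _ (bd_cocycle yb).
  have := @qis_coh_inj _ _ s (g y) 0 qs cgy (cocycle0 _).
  rewrite /cohomologous linear0 !subr0; apply.
  exact: coh_bd (coh_sym ygy) yb.
- move=> X Y Z u [uc ul ub] v [vc vl vb]; split=> [x /vc/uc|c x y cx cy|x /vb/ub] //=.
  apply: coh_trans (ul c _ _ (vc _ cx) (vc _ cy)).
  apply: coh_linear_coh => //; [exact/vc/cocycle_lin| |exact: vl].
  by apply: cocycle_lin; apply: vc.
- move=> X Y u [uc ul ub] v [vc vl vb]; split=> [x cx|c x y cx cy|x xb] /=.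
  + by apply: cocycleD; [apply: uc|apply: vc].
  + by rewrite scalerDr addrACA; apply: cohD; [apply: ul|apply: vl].
  + by apply: bdD; [apply: ub|apply: vb].
- move=> X Y a u [uc ul ub]; split=> [x cx|c x y cx cy|x xb] /=.
  + by apply/cocycleZ/uc.
  + by rewrite scalerA mulrC -scalerA -scalerDr; apply/cohZ/ul.
  + by apply/bdZ/ub.
Qed.

(** Each defining relation of the localization holds on cohomology. For formal inverses this is the
    bijectivity of a quasi-isomorphism on classes. *)
Lemma coh_word_eq X Y (u v : word (@qis k A) X Y) : weq u v ->
  forall x, cocycle x -> cohomologous (coh_word u x) (coh_word v x).
Proof.
have cW Z T (w : word (@qis k A) Z T) x : cocycle x -> cocycle (coh_word w x).
  by have [h _ _] := coh_word_linear w; apply: h.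
elim=> {X Y u v} /=.
all: try by [move=> *; rewrite ?lfunE /= ?lfunE /=; apply: coh_refl].
- by move=> X Y u v _ IH x /IH/coh_sym.
- by move=> X Y u v w _ IH _ IH' x cx; apply: coh_trans (IH _ cx) (IH' _ cx).
- move=> X Y Z u u' v v' _ IH _ IH' x cx.
  apply: coh_trans (IH _ (cW _ _ _ _ cx)); apply: coh_linear_coh; try exact: cW.
    exact: coh_word_linear.
  exact: IH'.
- by move=> X Y u u' v v' _ IH _ IH' x cx; apply: cohD; [apply: IH|apply: IH'].
- by move=> X Y a u u' _ IH x cx; apply: cohZ; apply: IH.
- by move=> *; rewrite addrA; apply: coh_refl.
- by move=> *; rewrite addrC; apply: coh_refl.
- by move=> *; rewrite lfunE add0r; apply: coh_refl.
- by move=> *; rewrite lfunE scaleN1r addNr; apply: coh_refl.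
- by move=> *; rewrite scalerA; apply: coh_refl.
- by move=> *; rewrite scale1r; apply: coh_refl.
- by move=> *; rewrite scalerDr; apply: coh_refl.
- by move=> *; rewrite scalerDl; apply: coh_refl.
- move=> X Y Z u v w x cx; apply: coh_linearD; try exact: cW.
  exact: coh_word_linear.
- move=> X Y Z a u w x cx; apply: coh_linearZ; try exact: cW.
  exact: coh_word_linear.
- move=> X Y s qs x cx; rewrite id_lfunE.
  have [cg xg] := coh_wordV qs (cocycle_chm s cx).
  exact: (qis_coh_inj qs cg cx (coh_sym xg)).
- move=> X Y s qs x cx; rewrite id_lfunE.
  by have [cg xg] := coh_wordV qs cx; apply: coh_sym.
Qed.

(** This brings equations of the derived category back to elements. *)
Lemma fmor_coh X Y (f g : @hom _ (Cb A) X Y) x :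
  fmor (CbDb A) f = fmor (CbDb A) g -> cocycle x -> cohomologous (f n x) (g n x).
Proof. by move=> /wclass_eq/coh_word_eq; apply. Qed.

End Cohomology.

(** * Morphisms out of a free module of rank one placed in a single degree *)

Section Regular.
Variables (k : fieldType) (A : falgType k).
Implicit Types P U V W X Y Z : complex A.

(* P is isomorphic to A in degree n: rgen is the generator in degree n and 0  *)
(* in the others. Families over all degrees make the notion stable under      *)
(* shift_ob without casts along equalities of degrees.                        *)
Record regular_at (P : complex A) (n : int) := RegularAt {
  rgen : forall i, P i;
  rcoord : forall i, P i -> A;
  rcoord_linear : forall i, linear (@rcoord i);
  rcoord_act : forall i a x, rcoord (act a x) = a * @rcoord i x;
  rcoordK : forall i (x : P i), act (rcoord x) (rgen i) = x;
  rgen0 : forall i, i != n -> rgen i = 0;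
  rcoord_gen : rcoord (rgen n) = 1 }.

Lemma act0 (M : fdmod A) (x : M) : act (0 : A) x = 0.
Proof.
by have := act_linearl x (-1) 0 0; rewrite scaler0 addr0 scaleN1r addNr.
Qed.

Lemma rcoord0 P n (R : regular_at P n) i : rcoord R (0 : P i) = 0.
Proof.
by have := @rcoord_linear _ _ R i (-1) 0 0; rewrite scaler0 addr0 scaleN1r addNr.
Qed.

Definition concentrated X (n : int) := forall i, i != n -> forall x : X i, x = 0.

Lemma regular_concentrated P n : regular_at P n -> concentrated P n.
Proof. by move=> R i ni x; rewrite -(rcoordK R x) rgen0 // linear0. Qed.

Definition family X n (x : X n) (i : int) : X i :=
  match n =P i with
  | ReflectT e => eq_rect n (fun j : int => X j : Type) x i e
  | ReflectF _ => 0
  end.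

Lemma familyE X n (x : X n) : family x n = x.
Proof. by rewrite /family; case: eqP => // e; rewrite (Prop_irrelevance e erefl). Qed.

Section Eval.
Variables (P X : complex A) (n : int) (R : regular_at P n) (x : X n).
Hypothesis cx : cocycle x.

(** The [A]-linear map that sends the generator to [x]; it is a chain map because [x] is a
    cocycle. *)
Definition eval_fun i (p : P i) : X i := act (rcoord R p) (family x i).
Fact eval_linear i : linear (@eval_fun i).
Proof.
by move=> c p q; rewrite /eval_fun rcoord_linear (act_linearl (family x i)).
Qed.
HB.instance Definition _ i := GRing.isLinear.Build k (P i) (X i) _
  (@eval_fun i) (@eval_linear i).
Fact eval_act i a (p : P i) :
  linfun (@eval_fun i) (act a p) = act a (linfun (@eval_fun i) p).
Proof.
rewrite !lfunE /= /eval_fun rcoord_act.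
by case: (actP (X i)) => _ _ _ ->.
Qed.
Fact eval_diff i (p : P i) :
  diff X i (linfun (@eval_fun i) p) = linfun (@eval_fun (i + 1)) (diff P i p).
Proof.
have conc := regular_concentrated R.
have -> : diff P i p = 0.
  have [ein|] := eqVneq i n; last by move=> ni; rewrite [p]conc // linear0.
  by apply: conc; rewrite ein; lia.
rewrite linear0 lfunE /= /eval_fun diff_act.
have -> : diff X i (family x i) = 0; last exact: linear0.
by rewrite /family; case: eqP => [e|_]; [case: _ / e|exact: linear0].
Qed.
Definition eval_map : @hom _ (Cb A) P X :=
  @Chmap _ _ P X (fun i => linfun (@eval_fun i)) eval_act eval_diff.

Lemma eval_mapE : eval_map n (rgen R n) = x.
Proof.
rewrite lfunE /= /eval_fun rcoord_gen familyE.
by case: (actP (X n)) => _ _ ->.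
Qed.
End Eval.

Lemma rgen_cocycle P n (R : regular_at P n) : cocycle (rgen R n).
Proof.
apply: (regular_concentrated R).
by lia.
Qed.

Lemma regular_chmapP P X n (R : regular_at P n) (f g : chmap P X) :
  f n (rgen R n) = g n (rgen R n) -> f = g.
Proof.
move=> e; apply: chmapP => i p; rewrite -(rcoordK R p) !chm_act; congr act.
have [->//|ni] := eqVneq i n; by rewrite rgen0 // !linear0.
Qed.

(** If the generator goes to the boundary of [z], the [A]-linear map sending the generator to [z] is
    a null-homotopy. *)
Lemma regular_homotopic0 P X n (R : regular_at P n) (f : @hom _ (Cb A) P X) :
  bd (f n (rgen R n)) -> fmor (CbDb A) f = hzero (P : Db A) X.
Proof.
have [m em] := int_pred n; move: R; rewrite em => {n em} R /bdP[z fz].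
pose hf i (p : P (i + 1)) : X i := act (rcoord R p) (family z i).
have hl i : linear (@hf i).
  by move=> c p q; rewrite /hf rcoord_linear (act_linearl (family z i)).
pose hL i := GRing.isLinear.Build k (P (i + 1)) (X i) _ (@hf i) (@hl i).
pose hM i : {linear P (i + 1) -> X i} := HB.pack (@hf i) (hL i).
apply: (homotopic0 (h := fun i => linfun (hM i))) => [i a p|i p].
  rewrite !lfunE /= /hf rcoord_act.
  by case: (actP (X i)) => _ _ _ ->.
have conc := regular_concentrated R.
rewrite !lfunE /= /hf diff_act.
have [eim|nim] := eqVneq i m.
  subst i; rewrite [diff P _ p]conc ?rcoord0 ?act0 ?addr0.
    by rewrite -[in LHS](rcoordK R p) chm_act fz familyE.
  by lia.
have p0 : p = 0 by apply: conc; apply: contra nim => /eqP/addIr ->.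
by rewrite p0 !linear0 !rcoord0 !act0 addr0.
Qed.

End Regular.

(** * Stalk complexes of free modules *)

Section RegularStalk.
Variables (k : fieldType) (A : falgType k) (n : int).

Definition regular_stalk_mod (i : int) : fdmod A :=
  if i == n then regular A else fdmod0 A.
Fact regular_stalk_complex : complex_axiom
  (fun i => 0 : 'Hom(regular_stalk_mod i, regular_stalk_mod (i + 1))).
Proof.
split=> [i a x|i x|]; rewrite ?lfunE ?linear0 //.
exists `|n|%N => i; rewrite /regular_stalk_mod; case: (eqVneq i n) => [->|_ _ x].
  by rewrite -abszE ltxx.
exact: thinmx0.
Qed.
Definition regular_stalk : complex A := Complex regular_stalk_complex.

Lemma regular_stalk_at : regular_at regular_stalk n.
Proof.
(* With [i == n] abstracted to a boolean, the module in degree [i] is [M (i == n)] by conversion and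
   no cast arises. *)
pose M (b : bool) : fdmod A := if b then regular A else fdmod0 A.
pose e (b : bool) : M b := match b with true => 1 : A | false => 0 end.
pose c (b : bool) : M b -> A :=
  match b with true => fun x => x | false => fun _ => 0 end.
have cl b : linear (@c b) by case: b => a x y //=; rewrite scaler0 addr0.
have ca b a x : c b (act a x) = a * c b x by case: b x => //= x; rewrite mulr0.
have cK b (x : M b) : act (c b x) (e b) = x.
  by case: b x => x; [exact: mulr1|rewrite [RHS]thinmx0].
apply: (@RegularAt _ _ regular_stalk n (fun i => e (i == n))
                   (fun i => @c (i == n))) => [i|i|i|i /negPf|].
- exact: cl.
- exact: ca.
- exact: cK.
- by rewrite /= /regular_stalk_mod => ->.
- by rewrite /= eqxx.
Qed.

End RegularStalk.

Lemma stalk_regularE (k : fieldType) (A : falgType k) :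
  stalk (regular A) = regular_stalk A 0.
Proof.
by rewrite /stalk /regular_stalk; congr Complex; apply: Prop_irrelevance.
Qed.

Section RegularTheory.
Variables (k : fieldType) (A : falgType k).
Implicit Types P U V W X Y Z : complex A.

Lemma stalk_regular_at : regular_at (stalk (regular A)) 0.
Proof. rewrite stalk_regularE; exact: regular_stalk_at. Qed.

Lemma shift_regular_at P n (R : regular_at P n) : regular_at (shift_ob P) (n - 1).
Proof.
apply: (@RegularAt _ _ (shift_ob P) (n - 1) (fun i => rgen R (i + 1))
                   (fun i => @rcoord _ _ _ _ R (i + 1))).
- by move=> i; apply: (rcoord_linear R).
- by move=> i; apply: (rcoord_act R).
- by move=> i; apply: (rcoordK R).
- by move=> i ni; apply: (rgen0 R); lia.
- by rewrite subrK; apply: rcoord_gen.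
Qed.

(** In a fraction with denominator [s] and numerator [f], the image of the generator under [f] lifts
    along [s], up to a boundary, to a cocycle of [X]. Evaluation at that cocycle represents [u]. *)
Lemma regular_full P X n (R : regular_at P n) (u : @hom _ (Db A) P X) :
  exists z : @hom _ (Cb A) P X, u = fmor (CbDb A) z.
Proof.
have [V [s [f [qs su]]]] := left_fraction u.
have cf : cocycle (f n (rgen R n)) by apply/cocycle_chm/rgen_cocycle.
have [x xP] := qis_lift (f n (rgen R n)) qs.
have [cx fx] := xP cf.
exists (eval_map R cx); apply: (isom_monol (qis_isom qs)).
rewrite [LHS]su -[RHS]CbDbM; apply: CbDb_inj.
apply: (regular_homotopic0 (R := R)); rewrite /= !lfunE /= lfunE /= comp_lfunE.
by rewrite (eval_mapE R cx) scaleN1r.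
Qed.

(** * Subcomplexes, truncation and detection of morphisms *)

Section Sub.
Variables (V : complex A) (S : forall i, {vspace V i}).
Hypothesis SA : forall i a x, x \in S i -> act a x \in S i.
Hypothesis SD : forall i x, x \in S i -> diff V i x \in S (i + 1).

Definition sub_act i (a : A) (x : subvs_of (S i)) : subvs_of (S i) :=
  Subvs (SA a (subvsP x)).
Fact sub_module i : module_axiom (@sub_act i).
Proof.
split=> [v c a b|a c u v|v|a b v]; apply: val_inj; rewrite /= ?linearP //=.
- by rewrite act_linearl.
- by case: (actP (V i)) => _ _ ->.
- by case: (actP (V i)) => _ _ _ ->.
Qed.
Definition sub_mod i := FdMod (@sub_module i).
Definition sub_fun i (x : sub_mod i) : sub_mod (i + 1) := Subvs (SD (subvsP x)).
Fact sub_linear i : linear (@sub_fun i).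
Proof. by move=> c u v; apply: val_inj; rewrite /= !linearP. Qed.
HB.instance Definition _ i := GRing.isLinear.Build k (sub_mod i) (sub_mod (i + 1)) _
  (@sub_fun i) (@sub_linear i).
Fact sub_complexP : complex_axiom (fun i => linfun (@sub_fun i)).
Proof.
split=> [i a x|i x|].
- by rewrite !lfunE; apply: val_inj; rewrite /= diff_act.
- by rewrite !lfunE; apply: val_inj; rewrite /= diffK.
case: (complexP V) => _ _ [n nV]; exists n => i ni x; apply: val_inj.
exact: nV.
Qed.
Definition sub_complex : complex A := Complex sub_complexP.

Lemma sub_act_val i a (x : sub_complex i) :
  linfun vsval (act a x) = act a (linfun (vsval : sub_mod i -> V i) x).
Proof. by rewrite !lfunE. Qed.
Lemma sub_diff_val i (x : sub_complex i) :
  diff V i (linfun (vsval : sub_mod i -> V i) x) =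
  linfun (vsval : sub_mod (i + 1) -> V (i + 1)) (diff sub_complex i x).
Proof. by rewrite !lfunE. Qed.
Definition sub_incl : chmap sub_complex V :=
  @Chmap _ _ sub_complex V (fun i => linfun (vsval : sub_mod i -> V i))
    sub_act_val sub_diff_val.

Lemma sub_acyclic :
  (forall i (x : V (i + 1)), x \in S (i + 1) -> diff V (i + 1) x = 0 ->
     exists2 z, z \in S i & x = diff V i z) -> acyclic sub_complex.
Proof.
move=> h i; have [j ->] := int_pred i => x.
rewrite lfunE => /(congr1 vsval) /= dx.
have [z zS xz] := h _ _ (subvsP x) dx.
by apply/bdP; exists (Subvs zS); rewrite lfunE; apply: val_inj.
Qed.

Section Corestriction.
Variables (X : complex A) (f : chmap X V).
Hypothesis fS : forall i x, f i x \in S i.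
Definition cores_fun i (x : X i) : sub_complex i := Subvs (fS x).
Fact cores_linear i : linear (@cores_fun i).
Proof. by move=> c u v; apply: val_inj; rewrite /= linearP. Qed.
HB.instance Definition _ i := GRing.isLinear.Build k (X i) (sub_complex i) _
  (@cores_fun i) (@cores_linear i).
Fact cores_act i a (x : X i) :
  linfun (@cores_fun i) (act a x) = act a (linfun (@cores_fun i) x).
Proof. by rewrite !lfunE; apply: val_inj; rewrite /= chm_act. Qed.
Fact cores_diff i (x : X i) : diff sub_complex i (linfun (@cores_fun i) x) =
  linfun (@cores_fun (i + 1)) (diff X i x).
Proof. by rewrite !lfunE; apply: val_inj; rewrite /= chm_diff. Qed.
Definition corestriction : chmap X sub_complex :=
  @Chmap _ _ X sub_complex (fun i => linfun (@cores_fun i)) cores_act cores_diff.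

Lemma sub_factor : acyclic sub_complex ->
  fmor (CbDb A) (f : @hom _ (Cb A) X V) = hzero (X : Db A) V.
Proof.
move=> ac; rewrite -(acyclic_factor sub_incl corestriction ac); congr fmor.
by apply: chmapP => i x; rewrite comp_lfunE !lfunE.
Qed.
End Corestriction.
End Sub.

Lemma bd_vspace V i : exists S : {vspace V i}, forall x, x \in S <-> bd x.
Proof.
have [j ->] := int_pred i; exists (limg (diff V j)) => x; split.
  by move=> /memv_imgP[z _ ->]; apply: Bd.
by move=> /bdP[z ->]; rewrite memv_img ?memvf.
Qed.

(* f factors through the subcomplex of V made of V in degrees < n and of the  *)
(* boundaries in degree n, which is acyclic.                                  *)
Lemma truncate0 X V n (f : chmap X V) : concentrated X n ->
  (forall i, i < n -> forall x : V i, diff V i x = 0 -> bd x) ->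
  (forall x, bd (f n x)) ->
  fmor (CbDb A) (f : @hom _ (Cb A) X V) = hzero (X : Db A) V.
Proof.
move=> Xn Vn fn.
have ex i : exists S : {vspace V i}, forall x, x \in S <->
    [\/ i < n, (i = n /\ bd x) | x = 0].
  have [|ni|->] := ltgtP i n.
  - by exists fullv => x; rewrite memvf; split=> // _; constructor 1.
  - exists 0%VS => x; rewrite memv0; split=> [/eqP ->|]; first by constructor 3.
    by move=> [//|[e _]|-> //]; exfalso; move: ni; rewrite e ltxx.
  have [S SP] := bd_vspace V n; exists S => x; rewrite SP; split.
    by constructor 2.
  by move=> [|[]|->] //; rewrite ?ltxx //; apply: bd0.
pose S i := projT1 (cid (ex i)).
have SP i x : x \in S i <-> [\/ i < n, (i = n /\ bd x) | x = 0].
  by rewrite /S; case: cid.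
have SA i a x : x \in S i -> act a x \in S i.
  move=> /SP h; apply/SP; case: h => [?|[? ?]|->].
  - by constructor 1.
  - by constructor 2; split=> //; apply: bd_act.
  - by constructor 3; rewrite linear0.
have SD i x : x \in S i -> diff V i x \in S (i + 1).
  move=> /SP h; apply/SP; case: h => [ltin|[ein bx]|->].
  - have [e|ne] := eqVneq (i + 1) n; first by constructor 2; split=> //; apply: Bd.
    by constructor 1; lia.
  - by constructor 3; apply: bd_cocycle.
  - by constructor 3; rewrite linear0.
apply: (@sub_factor V S SA SD).
  move=> i x; apply/SP; have [e|ne] := eqVneq i n; first by subst i; constructor 2.
  by constructor 3; rewrite [x]Xn // linear0.
apply: sub_acyclic => i x /SP h dx.
(* Below degree [n] the subspace [S] is everything, so any preimage found there already lies in the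
   subcomplex. *)
have lift z : i < n -> x = diff V i z -> exists2 z, z \in S i & x = diff V i z.
  by move=> ltin ->; exists z => //; apply/SP; constructor 1.
case: h => [ltin|[ein /bdP[z]]|->].
- have [z xz] := (bdP _).1 (Vn _ ltin _ dx); apply: lift xz; lia.
- by apply: lift; lia.
- by exists 0; rewrite ?mem0v ?linear0.
Qed.

(** Write [g] as a fraction through [V]. Testing [g] on evaluations at cocycles of [X] shows that
    the numerator sends [X n] into boundaries, and [truncate0] then makes it 0. *)
Lemma concentrated_hom0 P X W n (R : regular_at P n) (g : @hom _ (Db A) X W) :
  concentrated X n -> concentrated W n ->
  (forall v : @hom _ (Db A) P X, g \com v = hzero (P : Db A) W) ->
  g = hzero (X : Db A) W.
Proof.
move=> Xn Wn gv.
have [V [s [f [qs sg]]]] := left_fraction g.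
suff f0 : fmor (CbDb A) f = hzero (X : Db A) V.
  by apply: (isom_monol (qis_isom qs)); rewrite [LHS]sg f0 compm0.
(* Since [s] is a quasi-isomorphism and [W] is 0 below degree [n], [V] has no cohomology there. *)
apply: (truncate0 Xn) => [i ltin x dx|x].
  have [y _] := ((qisP s).1 qs i).2 x dx.
  by rewrite [y]Wn ?linear0 ?addr0 //; lia.
have cx : cocycle x by apply: Xn; lia.
have e : fmor (CbDb A) (f \com eval_map R cx) = fmor (CbDb A) (hzero (P : Cb A) V).
  by rewrite CbDbM -sg -compA gv compm0 fmor0.
have := fmor_coh e (rgen_cocycle R).
by rewrite /cohomologous comp_lfunE eval_mapE lfunE subr0.
Qed.

End RegularTheory.

(** * Elements of the extended centre as natural transformations *)

Section LeftMultiplication.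
Variables (k : fieldType) (H : groupType) (A : falgType k).
Variable phi : alg_action H A.
Implicit Types P X Y : complex A.

Lemma derived_actionE h X Y (f : @hom _ (Cb A) X Y) :
  fmor (derived_action phi h) (fmor (CbDb A) f) =
  fmor (CbDb A) (fmor (complex_action phi h) f).
Proof. exact: (@loc_functor_mor k H (Cb A)). Qed.

Lemma lmulE a f (af : ext_central phi a f) X i x : lmul af X i x = act a x.
Proof. by rewrite lfunE. Qed.

Lemma derived_lmul_natural a f (af : ext_central phi a f) :
  @natural _ _ _ (fidentity (Db A)) (derived_action phi f^-1%g) (derived_lmul af).
Proof.
apply: (@loc_natural k (Cb A) (@qis k A) _ (fidentity _)) => X Y g.
rewrite [fmor (derived_action _ _) _]derived_actionE.
rewrite /derived_lmul -[RHS]CbDbM -[LHS]CbDbM; apply: CbDb_eq => i x.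
by rewrite !comp_lfunE !lmulE /= chm_act.
Qed.

Lemma derived_lmul_lin c a b f (af : ext_central phi a f) (bf : ext_central phi b f)
    (cf : ext_central phi (c *: a + b) f) X :
  derived_lmul cf X = hadd (hscale c (derived_lmul af X)) (derived_lmul bf X).
Proof.
transitivity (fmor (CbDb A) (hadd (hscale c (lmul af X)) (lmul bf X))).
  apply: CbDb_eq => i x.
  by rewrite lmulE !lfunE /= !lfunE /= !lfunE /= act_linearl.
by rewrite fmorD fmorZ.
Qed.

(** Twisting leaves the underlying spaces unchanged, so the identification comes from a chain map
    that is the identity on elements. *)
Lemma idto_action h g l X
    (e : derived_action phi h (derived_action phi g X) = derived_action phi l X) :
  l = (h * g)%g ->
  exists2 j : @hom _ (Cb A) (complex_action phi h (complex_action phi g X))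
      (complex_action phi l X),
    idto e = fmor (CbDb A) j & forall i (x : X i), j i x = x.
Proof.
move=> el; subst l; exists (idto (sactM (complex_action phi) h g X)) => [|i x].
  by rewrite -[RHS]idto_loc; congr idto; apply: Prop_irrelevance.
exact: twME.
Qed.

Lemma derived_lmulM a f b g (af : ext_central phi a f) (bg : ext_central phi b g)
    (abfg : ext_central phi (a * b) (f * g)%g) X
    (e : derived_action phi g^-1%g (derived_action phi f^-1%g X) =
         derived_action phi (f * g)^-1%g X) :
  derived_lmul abfg X =
  idto e \com (fmor (derived_action phi g^-1%g) (derived_lmul af X) \com
               derived_lmul bg X).
Proof.
have [j -> jE] := idto_action e (invgM f g).
rewrite [X in _ \com (X \com _)]derived_actionE.
rewrite /derived_lmul -[X in _ \com X]CbDbM -[RHS]CbDbM.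
apply: CbDb_eq => i x.
rewrite !comp_lfunE jE !lmulE /= lfunE.
by case: (actP (X i)) => _ _ _ ->.
Qed.

Lemma derived_lmul1 (c1 : ext_central phi 1 1%g) X
    (e : derived_action phi 1^-1%g X = X) :
  idto e \com derived_lmul c1 X = idm (X : Db A).
Proof.
have [j -> jE] : exists2 j : @hom _ (Cb A) (complex_action phi 1^-1%g X) X,
    idto e = fmor (CbDb A) j & forall i (x : X i), j i x = x.
  move: e; rewrite invg1 => e.
  exists (idto (sact1 (complex_action phi) X)) => [|i x]; last exact: tw1E.
  by rewrite -[RHS]idto_loc; congr idto; apply: Prop_irrelevance.
rewrite -[LHS]CbDbM; apply: CbDb_eq => i x.
by rewrite comp_lfunE lmulE jE id_lfunE; case: (actP (X i)) => _ _ ->.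
Qed.

(** Represent [nu] by a chain map [z] and read off [a] from the image of the generator [e]. The
    endomorphism sending [e] to [c e] is right multiplication by [c]; commuting with it gives
    [a * c = phi f c * a]. *)
Lemma derived_lmul_regular P n (R : regular_at P n) f
    (nu : @hom _ (Db A) P (derived_action phi f^-1%g P)) :
  (forall v : @hom _ (Db A) P P,
     nu \com v = fmor (derived_action phi f^-1%g) v \com nu) ->
  exists a (af : ext_central phi a f), nu = derived_lmul af P.
Proof.
have [z ->] := regular_full R nu => nuv.
pose e := rgen R n; pose a := rcoord R (z n e : P n).
have ze : z n e = act a e :> P n by rewrite rcoordK.
have af : ext_central phi a f.
  move=> c.
  have cc : cocycle (act c e) by rewrite /cocycle diff_act rgen_cocycle linear0.
  have := nuv (fmor (CbDb A) (eval_map R cc)).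
  rewrite derived_actionE -[LHS]CbDbM -[RHS]CbDbM.
  move=> /fmor_coh/(_ (rgen_cocycle R)) h.
  (* The target of [z] is twisted, so [c] acts there as [phi f c]. *)
  have E1 : z n (act c e) = act (phi f c) (act a e) :> P n.
    by rewrite chm_act ze /= invgK.
  have E2 : eval_map R cc n (act a e) = act a (act c e).
    by rewrite chm_act (eval_mapE R cc).
  have : @bd _ _ (complex_action phi f^-1%g P) n
      ((act (phi f c) (act a e) : P n) - act a (act c e)).
    rewrite -E1 -E2 -ze; move: h; rewrite /cohomologous !comp_lfunE.
    by rewrite (eval_mapE R cc).
  (* The complex is 0 in degree [n - 1], so equality up to a boundary in degree [n] is equality. *)
  move=> /bd_trivial' b0.
  have /b0/eqP : forall x : complex_action phi f^-1%g P (n - 1), x = 0.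
    by move=> x; apply: (regular_concentrated R); lia.
  rewrite subr_eq0 => /eqP /(congr1 (@rcoord _ _ _ _ R n)).
  by rewrite !rcoord_act rcoord_gen !mulr1.
exists a, af; have -> // : z = lmul af P.
by apply: (regular_chmapP (R := R)); rewrite lmulE.
Qed.

Lemma derived_lmul_inj P n (R : regular_at P n) a b f
    (af : ext_central phi a f) (bf : ext_central phi b f) :
  derived_lmul af P = derived_lmul bf P -> a = b.
Proof.
move=> /fmor_coh/(_ (rgen_cocycle R)); rewrite /cohomologous !lmulE.
move=> /bd_trivial' b0.
have /b0/eqP : forall x : complex_action phi f^-1%g P (n - 1), x = 0.
  by move=> x; apply: (regular_concentrated R); lia.
rewrite subr_eq0 => /eqP /(congr1 (@rcoord _ _ _ _ R n)).
by rewrite !rcoord_act rcoord_gen !mulr1.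
Qed.

End LeftMultiplication.

(** * The correspondence between extended-central pairs of the two actions *)

Section Transport.
Variables (k : fieldType) (H : groupType) (A B : falgType k).
Variables (phi : alg_action H A) (omega : alg_action H B).
Variables (F : functor (Db A) (Db B)) (G : functor (Db B) (Db A)).
Hypothesis FG : quasi_inverse F G.
Variable xi : intertwiner F (derived_action phi) (derived_action omega).

Let Q : Db B := stalk (regular B).
Let RQ : regular_at (stalk (regular B)) 0 := stalk_regular_at B.

Definition corresponds a f (af : ext_central phi a f) b (bf : ext_central omega b f) :=
  forall (X : Db A) (s : hom (F X) Q), isom s ->
    derived_lmul bf Q \com s =
    fmor (derived_action omega f^-1%g) s \com transport xi (derived_lmul af X).

Lemma transport_lmul a f (af : ext_central phi a f) (X Y : Db A) (u : hom X Y) :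
  transport xi (derived_lmul af Y) \com fmor F u =
  fmor (derived_action omega f^-1%g) (fmor F u) \com transport xi (derived_lmul af X).
Proof. exact: transport_natural (derived_lmul_natural af u). Qed.

(** One identification of [B] with an object [F X] suffices: by fullness any other differs from it
    by some [F u], and the transported transformation is natural with respect to [F u]. *)
Lemma corresponds_at a f (af : ext_central phi a f) b (bf : ext_central omega b f)
    X (s : hom (F X) Q) : isom s ->
  derived_lmul bf Q \com s =
    fmor (derived_action omega f^-1%g) s \com transport xi (derived_lmul af X) ->
  corresponds af bf.
Proof.
move=> si e X' s' s'i; have [t [ts st]] := si.
have [u Fu] := qinv_full FG (t \com s').
have -> : s' = s \com fmor F u by rewrite Fu compA st comp1m.
rewrite compA e -[LHS]compA.
rewrite transport_lmul.
by rewrite [LHS]compA -fmorM.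
Qed.

(** Conjugate the transported transformation at [F (G Q)] by the isomorphism with [Q]. Every
    endomorphism of [Q] becomes some [F u], so naturality supplies the commutation that
    [derived_lmul_regular] asks for. *)
Lemma corresponds_ex a f (af : ext_central phi a f) :
  exists b (bf : ext_central omega b f), corresponds af bf.
Proof.
have [s si] := qinv_isom FG Q; have [t [ts st]] := si.
pose eta := transport xi (derived_lmul af (G Q)).
pose nu := fmor (derived_action omega f^-1%g) s \com eta \com t.
have [|b [bf nub]] := derived_lmul_regular (nu := nu) RQ.
  move=> v; have [u Fu] := qinv_full FG (t \com v \com s).
  have tv : t \com v = fmor F u \com t by rewrite Fu -compA st compm1.
  have sv : s \com fmor F u = v \com s.
    by rewrite Fu [LHS]compA [s \com _]compA st comp1m.
  rewrite /nu -[LHS]compA tv [LHS]compA -[X in X \com _]compA.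
  rewrite transport_lmul -/eta.
  rewrite [X in X \com _]compA -fmorM sv fmorM.
  by rewrite -!compA.
exists b, bf; apply: corresponds_at si _.
by rewrite -nub /nu -[LHS]compA ts compm1.
Qed.

Lemma corresponds_uniq a f (af : ext_central phi a f) b b'
    (bf : ext_central omega b f) (b'f : ext_central omega b' f) :
  corresponds af bf -> corresponds af b'f -> b = b'.
Proof.
have [s si] := qinv_isom FG Q => c c'.
apply: (derived_lmul_inj RQ (af := bf) (bf := b'f)).
by apply: (isom_monor si); rewrite c // c'.
Qed.

Lemma corresponds_lin c a b f (af : ext_central phi a f) (bf : ext_central phi b f)
    (abf : ext_central phi (c *: a + b) f) a' b'
    (af' : ext_central omega a' f) (bf' : ext_central omega b' f)
    (abf' : ext_central omega (c *: a' + b') f) :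
  corresponds af af' -> corresponds bf bf' -> corresponds abf abf'.
Proof.
move=> ca cb X s si.
rewrite (derived_lmul_lin af' bf') (derived_lmul_lin af bf) /transport.
by rewrite compDl compZl ca // cb // fmorD fmorZ !compDr !compZr.
Qed.

Lemma corresponds1 (c1 : ext_central phi 1 1%g) (c1' : ext_central omega 1 1%g) :
  corresponds c1 c1'.
Proof.
move=> X s si.
have e Z : derived_action phi 1^-1%g Z = Z by rewrite invg1 sact1.
have e' Z : derived_action omega 1^-1%g Z = Z by rewrite invg1 sact1.
apply: (isom_monol (isom_idto (e' Q))).
rewrite compA derived_lmul1 comp1m [RHS]compA (sact1_mor_eq _ (e' (F X))) ?invg1 //.
rewrite -[RHS]compA (transport_unit xi (e := e X)) ?invg1 ?compm1 //.
exact: derived_lmul1.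
Qed.

Lemma correspondsM a b f g (af : ext_central phi a f) (bg : ext_central phi b g)
    (abfg : ext_central phi (a * b) (f * g)%g) a' b'
    (af' : ext_central omega a' f) (bg' : ext_central omega b' g)
    (abfg' : ext_central omega (a' * b') (f * g)%g) :
  corresponds af af' -> corresponds bg bg' -> corresponds abfg abfg'.
Proof.
move=> ca cb X s si.
have e Z : derived_action phi g^-1%g (derived_action phi f^-1%g Z) =
    derived_action phi (f * g)^-1%g Z by rewrite sactM invgM.
have e' Z : derived_action omega g^-1%g (derived_action omega f^-1%g Z) =
    derived_action omega (f * g)^-1%g Z by rewrite sactM invgM.
rewrite (derived_lmulM af bg abfg (e X)) (derived_lmulM af' bg' abfg' (e' Q)).
rewrite (transport_comp xi _ _ _ (e' (F X)) (invgM f g)).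
rewrite [RHS]compA (sactM_mor_eq _ (e' (F X)) (e' Q) (invgM f g)).
rewrite -[LHS]compA -[RHS]compA; congr (_ \com _).
rewrite [RHS]compA -fmorM -ca // fmorM -[LHS]compA -[RHS]compA.
by rewrite cb.
Qed.

(** The default 0 makes the function total, so that it can be applied to the coefficients of any
    element of the group algebra. *)
Definition theta_coef f (a : A) : B :=
  if pselect (ext_central phi a f) is left af then projT1 (cid (corresponds_ex af))
  else 0.

Lemma theta_coefP a f (af : ext_central phi a f) :
  exists bf : ext_central omega (theta_coef f a) f, corresponds af bf.
Proof.
rewrite /theta_coef; case: pselect => // af'; case: cid => b /= [bf c].
by exists bf; rewrite (Prop_irrelevance af af').
Qed.

Lemma theta_coefE a f (af : ext_central phi a f) b (bf : ext_central omega b f) :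
  corresponds af bf -> theta_coef f a = b.
Proof.
by move=> c; have [bf' c'] := theta_coefP af; apply: corresponds_uniq c' c.
Qed.

Lemma theta_coef_central a f : ext_central phi a f ->
  ext_central omega (theta_coef f a) f.
Proof. by move=> af; have [bf _] := theta_coefP af. Qed.

End Transport.

(** * Coefficientwise description of the extended centre *)

Section ExtCentre.
Variables (k : fieldType) (H : groupType) (A : falgType k).
Variable phi : alg_action H A.

Lemma ext_central_lin c a b f : ext_central phi a f -> ext_central phi b f ->
  ext_central phi (c *: a + b) f.
Proof.
move=> af bf x; rewrite mulrDl mulrDr -scalerAl -scalerAr af bf.
by [].
Qed.

Lemma ext_central0 f : ext_central phi 0 f.
Proof. by move=> x; rewrite mul0r mulr0. Qed.

Lemma mcoeff_tens (a : A) (f g : H) : mcoeff g (tens a f) = if f == g then a else 0.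
Proof. by rewrite mcoeffU; case: eqP. Qed.

Lemma mcoeff_lin c (u v : galg A H) f :
  mcoeff f (c *: u + v) = c *: mcoeff f u + mcoeff f v.
Proof. by rewrite mcoeffD galg_scaleE. Qed.

(** For fixed [f], the elements [a] with [(a, f)] extended-central form a subspace, so a span of
    such pairs is determined degree by degree in [H]. *)
Lemma ext_centreP (u : galg A H) :
  u \in ext_centre_pred phi <-> forall f, ext_central phi (mcoeff f u) f.
Proof.
split=> [/asboolP[s sP ->] f|uP].
  elim: s sP => [|p s IH] sP; first by rewrite big_nil mcoeff0; apply: ext_central0.
  rewrite big_cons mcoeff_lin; apply: ext_central_lin.
    rewrite mcoeff_tens; case: eqP => [<-|_]; last exact: ext_central0.
    by apply: sP; rewrite mem_head.
  by apply: IH => q qs; apply: sP; rewrite inE qs orbT.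
rewrite [u]galgE; apply: rpred_sum => f _.
by apply/asboolP/in_ext_centre_tens.
Qed.

End ExtCentre.

(** * The induced morphism *)

Section Theta.
Variables (k : fieldType) (H : groupType) (A B : falgType k).
Variables (phi : alg_action H A) (omega : alg_action H B).
Variables (F : functor (Db A) (Db B)) (G : functor (Db B) (Db A)).
Hypothesis FG : quasi_inverse F G.
Variable xi : intertwiner F (derived_action phi) (derived_action omega).

Let th := theta_coef FG xi.

Lemma theta_coef_lin c a b f : ext_central phi a f -> ext_central phi b f ->
  th f (c *: a + b) = c *: th f a + th f b.
Proof.
move=> af bf; have [af' ca] := theta_coefP FG xi af.
have [bf' cb] := theta_coefP FG xi bf.
exact: (theta_coefE FG (corresponds_lin (ext_central_lin c af bf)
  (ext_central_lin c af' bf') ca cb)).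
Qed.

Lemma theta_coef0 f : th f 0 = 0.
Proof.
have := theta_coef_lin (-1) (ext_central0 phi f) (ext_central0 phi f).
by rewrite scaler0 addr0 scaleN1r addNr.
Qed.

Lemma theta_coefM a b f g : ext_central phi a f -> ext_central phi b g ->
  th (f * g)%g (a * b) = th f a * th g b.
Proof.
move=> af bg; have [af' ca] := theta_coefP FG xi af.
have [bg' cb] := theta_coefP FG xi bg.
exact: (theta_coefE FG (correspondsM (ext_centralM af bg)
  (ext_centralM af' bg') ca cb)).
Qed.

Lemma theta_coef1 : th 1%g 1 = 1.
Proof.
exact: (theta_coefE FG
  (corresponds1 xi (ext_central1 phi) (ext_central1 omega))).
Qed.

Definition theta_galg (u : galg A H) : galg B H :=
  \sum_(f <- msupp u) tens (th f (mcoeff f u)) f.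

Lemma mcoeff_theta u f : mcoeff f (theta_galg u) = th f (mcoeff f u).
Proof.
have -> : mcoeff f (theta_galg u) =
    \sum_(g <- msupp u) (if g == f then th g (mcoeff g u) else 0).
  rewrite /theta_galg; elim: (enum_fset (msupp u)) => [|g s IH].
    by rewrite !big_nil; apply: mcoeff0.
  by rewrite !big_cons -IH -mcoeff_tens -mcoeffD.
have [fu|fu] := boolP (f \in msupp u).
  by rewrite (bigD1_seq f) ?fset_uniq //= eqxx big1 ?addr0 // => g /negPf ->.
rewrite big1_seq => [|g /andP[_ gu]].
  by rewrite (mcoeff_outdom fu) theta_coef0.
by case: eqP => // gf; rewrite -gf gu in fu.
Qed.

Lemma theta_galg_centre u : u \in ext_centre_pred phi ->
  theta_galg u \in ext_centre_pred omega.
Proof.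
move=> /ext_centreP uP; apply/ext_centreP => f; rewrite mcoeff_theta.
exact: theta_coef_central.
Qed.

Lemma theta_galg_lin c u v :
  u \in ext_centre_pred phi -> v \in ext_centre_pred phi ->
  theta_galg (c *: u + v) = c *: theta_galg u + theta_galg v.
Proof.
move=> /ext_centreP uP /ext_centreP vP; apply: galgP => f.
by rewrite mcoeff_lin !mcoeff_theta mcoeff_lin theta_coef_lin.
Qed.

Lemma theta_galg_tens a f : ext_central phi a f ->
  theta_galg (tens a f) = tens (th f a) f.
Proof.
move=> af; apply: galgP => g; rewrite mcoeff_theta !mcoeff_tens.
by case: eqP => [<-|] //; rewrite theta_coef0.
Qed.

Lemma theta_galg_sum (I : Type) (r : seq I) (u : I -> galg A H) :
  (forall i, u i \in ext_centre_pred phi) ->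
  theta_galg (\sum_(i <- r) u i) = \sum_(i <- r) theta_galg (u i).
Proof.
move=> uP; elim: r => [|i r IH].
  by apply: galgP => f; rewrite !big_nil mcoeff_theta !mcoeff0 theta_coef0.
rewrite !big_cons -[u i]scale1r theta_galg_lin //; last exact: rpred_sum.
by rewrite !scale1r IH.
Qed.

(** The product is expanded into pure tensors. As [theta_galg] is additive only on the extended
    centre, each partial sum is shown to lie in it. *)
Lemma theta_galgM u v :
  u \in ext_centre_pred phi -> v \in ext_centre_pred phi ->
  theta_galg (u * v) = theta_galg u * theta_galg v.
Proof.
move=> /ext_centreP uP /ext_centreP vP.
have tP a f : ext_central phi a f -> tens a f \in ext_centre_pred phi.
  by move=> af; apply/asboolP/in_ext_centre_tens.
rewrite [u * v]/(galg_mul u v) theta_galg_sum => [|f]; last first.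
  by apply: rpred_sum => g _; apply/tP/ext_centralM.
rewrite mulr_suml; apply: eq_bigr => f _.
rewrite theta_galg_sum => [|g]; last exact/tP/ext_centralM.
rewrite mulr_sumr; apply: eq_bigr => g _.
rewrite theta_galg_tens; last exact: ext_centralM.
by rewrite theta_coefM // tens_mul.
Qed.

Definition theta (u : ext_centre phi) : ext_centre omega :=
  ExtCentre (theta_galg_centre (ext_valP u)).

Fact theta_linear : linear theta.
Proof. by move=> c u v; apply: val_inj; rewrite /= theta_galg_lin ?ext_valP. Qed.
HB.instance Definition _ := GRing.isLinear.Build k (ext_centre phi)
  (ext_centre omega) _ theta theta_linear.

Fact theta_monoid_morphism : monoid_morphism theta.
Proof.
split=> [|u v]; apply: val_inj; last by rewrite /= theta_galgM ?ext_valP.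
rewrite /= [LHS]theta_galg_tens; last exact: ext_central1.
by rewrite theta_coef1.
Qed.
HB.instance Definition _ := GRing.isMonoidMorphism.Build (ext_centre phi)
  (ext_centre omega) theta theta_monoid_morphism.

Lemma theta_induced : induced xi theta.
Proof.
move=> a f af; have [bf c] := theta_coefP FG xi af.
exists (th f a), bf; split; last exact: c.
by apply: val_inj; rewrite /= theta_galg_tens.
Qed.

(** The map acts on each coefficient separately, so preimages are chosen coefficient by coefficient
    and summed over the support. *)
Lemma theta_bijective :
  (forall a f, ext_central phi a f -> th f a = 0 -> a = 0) ->
  (forall b f, ext_central omega b f -> exists2 a, ext_central phi a f & th f a = b) ->
  bijective theta.
Proof.
move=> inj sur.
have tinj : injective theta.
  apply: raddf_inj => u /(congr1 (@ext_val _ _ _ _)) /= u0.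
  apply: val_inj; apply: galgP => f; rewrite [RHS]mcoeff0.
  apply: inj; first by move/ext_centreP: (ext_valP u).
  by rewrite -mcoeff_theta u0 mcoeff0.
have tsur v : exists u, theta u = v.
  have /ext_centreP vP := ext_valP v.
  have ex f : exists a, ext_central phi a f /\ th f a = mcoeff f (ext_val v).
    by have [a] := sur _ _ (vP f); exists a.
  pose a f := projT1 (cid (ex f)).
  have aP f : ext_central phi (a f) f /\ th f (a f) = mcoeff f (ext_val v).
    exact: projT2 (cid (ex f)).
  pose u : galg A H := \sum_(f <- msupp (ext_val v)) tens (a f) f.
  have uP : u \in ext_centre_pred phi.
    apply: rpred_sum => f _; apply/asboolP/in_ext_centre_tens.
    by have [] := aP f.
  exists (ExtCentre uP); apply: val_inj => /=.
  rewrite theta_galg_sum => [|f]; last first.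
    by apply/asboolP/in_ext_centre_tens; have [] := aP f.
  rewrite [RHS]galgE; apply: eq_bigr => f _.
  by have [af <-] := aP f; apply: theta_galg_tens.
exists (fun v => projT1 (cid (tsur v))) => [u|v]; last by case: cid.
by apply: tinj; case: cid.
Qed.

End Theta.

(** * Strong equivalences *)

Section Shifts.
Variables (k : fieldType) (A : falgType k).

Definition shiftn (p : nat) (X : complex A) : complex A := iter p (@shift_ob k A) X.

Lemma shiftn_regular p (P : complex A) n :
  regular_at P n -> exists R : regular_at (shiftn p P) (n - p%:Z), True.
Proof.
move=> R; elim: p => [|p [R' _]]; first by rewrite subr0; exists R.
have -> : n - p.+1%:Z = n - p%:Z - 1 by lia.
by exists (shift_regular_at R').
Qed.

Lemma shiftn_concentrated p (X : complex A) n :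
  concentrated X n -> concentrated (shiftn p X) (n - p%:Z).
Proof.
move=> Xn; elim: p => [|p IH]; first by rewrite subr0.
by move=> i ni; apply: IH; lia.
Qed.

Lemma shiftn_act0 p (X : complex A) a : (forall i (x : X i), act a x = 0) ->
  forall i (x : shiftn p X i), act a x = 0.
Proof. by move=> X0; elim: p => // p IH i; apply: IH. Qed.

Lemma shiftn_isomorphic p (X Y : complex A) :
  isomorphic (X : Db A) Y -> isomorphic (shiftn p X : Db A) (shiftn p Y).
Proof. by move=> XY; elim: p => // p IH; apply: (isomorphic_fmor (shift A) IH). Qed.

End Shifts.

Lemma triangulated_shiftn (k : fieldType) (A B : falgType k)
    (F : functor (Db A) (Db B)) p (X : complex A) : triangulated F ->
  isomorphic (F (shiftn p X)) (shiftn p (F X) : Db B).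
Proof.
move=> [t [tn ti] _]; elim: p => [|p IH]; first by exists (idm _); apply: isom_id.
apply: isomorphic_trans (isomorphic_fmor (shift B) IH).
by exists (t (shiftn p X)); apply: ti.
Qed.

Section LeftMultiplicationZero.
Variables (k : fieldType) (H : groupType) (A : falgType k).
Variables (phi : alg_action H A) (a : A) (f : H).
Hypothesis af : ext_central phi a f.

Lemma derived_lmul0 (X : complex A) : (forall i (x : X i), act a x = 0) ->
  derived_lmul af X = hzero (X : Db A) (derived_action phi f^-1%g X).
Proof.
move=> X0; rewrite /derived_lmul -[RHS](fmor0 (CbDb A)); apply: CbDb_eq => i x.
by rewrite lmulE lfunE X0.
Qed.

(** In degree [n] every element [x] of [X] is a cocycle and boundaries vanish. Precomposing with the
    evaluation at [x] therefore gives [a x = 0]. *)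
Lemma derived_lmul_eq0 (X : complex A) n : concentrated X n ->
  derived_lmul af X = hzero (X : Db A) (derived_action phi f^-1%g X) ->
  forall i (x : X i), act a x = 0.
Proof.
move=> Xn l0 i x; have [e|ni] := eqVneq i n; last by rewrite [x]Xn // linear0.
subst i; have cx : cocycle x by apply: Xn; lia.
have R := regular_stalk_at A n.
have : fmor (CbDb A) (lmul af X \com eval_map R cx) = fmor (CbDb A) (hzero _ _).
  by rewrite CbDbM [X in X \com _]l0 comp0m fmor0.
move=> /fmor_coh/(_ (rgen_cocycle R)); rewrite /cohomologous comp_lfunE.
rewrite (eval_mapE R cx) lmulE lfunE subr0 => /bd_trivial'; apply.
by move=> z; apply: Xn; lia.
Qed.

End LeftMultiplicationZero.

Section Strong.
Variables (k : fieldType) (H : groupType) (A B : falgType k).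
Variables (phi : alg_action H A) (omega : alg_action H B).
Variables (F : functor (Db A) (Db B)) (G : functor (Db B) (Db A)).
Hypothesis FG : quasi_inverse F G.
Variable xi : intertwiner F (derived_action phi) (derived_action omega).

Let Q : Db B := stalk (regular B).

(** Multiplication by [b] on all objects [F Z] is pulled back to a natural family [mu]. At [A] in
    degree [n] it is multiplication by some [a], which detection in degree [n] carries over to [Y],
    where [F Y] is [B]. *)
Lemma corresponds_surj (Y : complex A) n : isomorphic (G Q) Y ->
  concentrated Y n -> forall b f (bf : ext_central omega b f),
  exists a (af : ext_central phi a f), corresponds xi af bf.
Proof.
move=> GQY Yn b f bf.
have [s si] : isomorphic (F Y) Q.
  apply: isomorphic_trans (qinv_isom FG Q).
  exact: (isomorphic_fmor F (isomorphic_sym GQY)).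
have ex (Z : Db A) : exists mu, transport xi mu = derived_lmul bf (F Z).
  exact: (transport_lift xi FG).
pose mu Z := projT1 (cid (ex Z)).
have muE Z : transport xi (mu Z) = derived_lmul bf (F Z).
  exact: projT2 (cid (ex Z)).
have mun (Z Z' : Db A) (u : hom Z Z') :
    mu Z' \com u = fmor (derived_action phi f^-1%g) u \com mu Z.
  apply: (transport_natural_inv (xi := xi) FG); rewrite !muE.
  exact: (derived_lmul_natural bf).
have R := regular_stalk_at A n; set P := regular_stalk A n in R.
have [|a [af muP]] := derived_lmul_regular (nu := mu P) R.
  by move=> v; apply: mun.
exists a, af; apply: (corresponds_at FG si).
(* Both sides are natural and agree at [P], so their difference vanishes on every morphism from [P]
   to [Y]. *)
have muY : mu Y = derived_lmul af Y.
  apply: hadd_eq0; apply: (concentrated_hom0 (W := complex_action phi f^-1%g Y)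
    R Yn Yn) => v.
  rewrite compDl compZl mun muP -(derived_lmul_natural af v).
  by rewrite haddC haddN.
by rewrite -muY muE; apply: (derived_lmul_natural bf).
Qed.

Hypothesis Ftri : triangulated F.

(** First [a] annihilates [Y]. The transported transformation at a shift of [F A] is then tested on
    morphisms from a shift of [B], which is the image of a shift of [Y]; being 0 there, it is 0, and
    so is [a]. *)
Lemma corresponds_inj (Y : complex A) (Z : complex B) m n :
  isomorphic (G Q) Y -> concentrated Y n ->
  isomorphic (F (stalk (regular A))) Z -> concentrated Z m ->
  forall a f (af : ext_central phi a f) (f0 : ext_central omega 0 f),
  corresponds xi af f0 -> a = 0.
Proof.
move=> GQY Yn FAZ Zm a f af f0 c.
have [s si] : isomorphic (F Y) Q.
  apply: isomorphic_trans (qinv_isom FG Q).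
  exact: (isomorphic_fmor F (isomorphic_sym GQY)).
(* At [F Y], isomorphic to [B], the transported transformation is multiplication by 0. *)
have lY0 : derived_lmul af Y = hzero (Y : Db A) _.
  apply: (transport_inj FG (xi := xi)).
  apply: (isom_monol (isom_fmor (derived_action omega f^-1%g) si)).
  rewrite -c // derived_lmul0 => [|i x]; last exact: act0.
  by rewrite comp0m /transport fmor0 !compm0.
have aY := derived_lmul_eq0 Yn lY0.
(* [shiftn] only lowers degrees, so [F A] (degree [m]) and [B] (degree 0) are both shifted, by [p]
   and [q], into a common degree. *)
have [p [q epq]] : exists p q : nat, m - p%:Z = 0 - q%:Z.
  by case: m {Zm} => m; [exists m, 0%N|exists 0%N, m.+1]; lia.
have [RP _] := shiftn_regular p (stalk_regular_at A).
have [RQ _] := shiftn_regular q (stalk_regular_at B).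
set P := shiftn p _ in RP; set Q' := shiftn q _ in RQ.
have [al ali] : isomorphic (F P) (shiftn p Z : Db B).
  apply: isomorphic_trans (triangulated_shiftn p _ Ftri) _.
  exact: shiftn_isomorphic.
have [be bei] : isomorphic (F (shiftn q Y)) (Q' : Db B).
  apply: isomorphic_trans (triangulated_shiftn q _ Ftri) _.
  by apply: shiftn_isomorphic; exists s.
have Zc : concentrated (shiftn p Z) (0 - q%:Z).
  by rewrite -epq; apply: shiftn_concentrated.
have [al' [al'K alK']] := ali.
(* The transformation at [F P] is conjugated to [shiftn p Z], where [concentrated_hom0] applies. *)
pose ga := fmor (derived_action omega f^-1%g) al.
have gai : isom ga := isom_fmor _ ali.
pose g := ga \com transport xi (derived_lmul af P) \com al'.
have g0 : g = hzero (shiftn p Z : Db B) _.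
  apply: (concentrated_hom0 (W := complex_action omega f^-1%g (shiftn p Z))
    RQ Zc Zc) => v.
  apply: (isom_monor bei); rewrite comp0m.
  (* Through [al] and [be], the test morphism [v] is some [F u] with [u] starting at [shiftn q Y].
     By naturality [g] after [v] factors through multiplication by [a] there, which is 0. *)
  have [u Fu] := qinv_full FG (al' \com v \com be).
  have -> : g \com v \com be =
      ga \com (transport xi (derived_lmul af P) \com fmor F u).
    by rewrite Fu /g -!compA.
  rewrite transport_lmul.
  rewrite [derived_lmul af (shiftn q Y)]derived_lmul0; last exact: shiftn_act0.
  by rewrite /transport fmor0 !compm0.
have lP0 : derived_lmul af P = hzero (P : Db A) _.
  apply: (transport_inj FG (xi := xi)); apply: (isom_monol gai).
  rewrite -[LHS]compm1 -al'K [LHS]compA [X in X \com _]g0.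
  by rewrite comp0m /transport fmor0 !compm0.
apply: (derived_lmul_inj RP (af := af) (bf := ext_central0 phi f)).
rewrite lP0 derived_lmul0 // => i x; exact: act0.
Qed.

End Strong.

Theorem theorem16 (k : closedFieldType) (H : groupType) (A B : falgType k)
  (phi : alg_action H A) (omega : alg_action H B)
  (F : functor (Db A) (Db B)) (G : functor (Db B) (Db A))
  (Ftri : triangulated F) (FG : quasi_inverse F G)
  (xi : intertwiner F (derived_action phi) (derived_action omega)) :
  exists theta : {lrmorphism ext_centre phi -> ext_centre omega},
    induced xi theta /\ (strong F G -> bijective theta).
Proof.
exists (@theta _ _ _ _ _ _ _ _ FG xi); split; first exact: theta_induced.
move=> [[Z FAZ [m Zm]] [Y GQY [n Yn]]]; apply: theta_bijective => [a f af a0|b f bf].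
  have [bf] := theta_coefP FG xi af; move: bf; rewrite a0 => f0 c.
  exact: (corresponds_inj FG Ftri GQY Yn FAZ Zm c).
have [a [af c]] := corresponds_surj FG xi GQY Yn bf.
by exists a => //; apply: theta_coefE c.
Qed.
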